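(* Let $n\ge 1$, $N:=2^n$, and consider the $n$-qubit bilinear control system $\Sigma_b$ $$\dot\rho(t) = -\big(i\hat H_{u}(t) + \Gamma_{\gamma(t)}\big)\rho(t),\qquad \rho(0)=\rho_0\in\mathfrak{P}_1,$$ where $H_u(t)=H_0+\sum_{j=1}^m u_j(t)H_j$, with the bit-flip Lindblad generator on the $n$-th qubit $V_b:=\mathbb{1}_2^{\otimes(n-1)}\otimes\sigma_x/2$. Assume: (i) $\langle iH_0, iH_1,\dots,iH_m\rangle_{\mathrm{Lie}}=\mathfrak{su}(N)$; (ii) $H_0$ is diagonal in the computational basis; (iii) the noise amplitude is a piecewise constant control $\gamma(t)\in\{0,\gamma_*\}$ for a fixed $\gamma_*>0$, and there are no other sources of decoherence. Then for every $\rho_0\in\mathfrak{P}_1$, $$\overline{\mathfrak{Reach}_{\Sigma_b}(\rho_0)}=\{\rho\in\mathfrak{P}_1\,:\,\rho\prec\rho_0\},$$ i.e. every reachable state is majorised by $\rho_0$, and every $\rho\prec\rho_0$ can be approximated arbitrarily well by reachable states (in general only in the limit $\gamma_*T\to\infty$). *)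

(* Defs.v *)
From Stdlib Require Import Reals Lra.
Open Scope R_scope.

Record C := mkC { re : R; im : R }.
Definition C0 : C := mkC 0 0.
Definition C1 : C := mkC 1 0.
Definition Ci : C := mkC 0 1.
Definition RtoC (r : R) : C := mkC r 0.
Definition Cadd (a b : C) : C := mkC (re a + re b) (im a + im b).
Definition Copp (a : C) : C := mkC (- re a) (- im a).
Definition Csub (a b : C) : C := Cadd a (Copp b).
Definition Cmul (a b : C) : C :=
  mkC (re a * re b - im a * im b) (re a * im b + im a * re b).
Definition Cconj (a : C) : C := mkC (re a) (- im a).

Fixpoint Csum (n : nat) (f : nat -> C) : C :=
  match n with O => C0 | S k => Cadd (Csum k f) (f k) end.
Fixpoint Rsum (n : nat) (f : nat -> R) : R :=
  match n with O => 0 | S k => Rsum k f + f k end.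

(* ---------- matrices: only indices < N are meaningful ---------- *)
Definition Mat := nat -> nat -> C.
Definition Vec := nat -> C.

Definition meq (N : nat) (A B : Mat) : Prop :=
  forall i j, (i < N)%nat -> (j < N)%nat -> A i j = B i j.
Definition mzero : Mat := fun _ _ => C0.
Definition mid : Mat := fun i j => if Nat.eqb i j then C1 else C0.
Definition madd (A B : Mat) : Mat := fun i j => Cadd (A i j) (B i j).
Definition msub (A B : Mat) : Mat := fun i j => Csub (A i j) (B i j).
Definition mscale (c : C) (A : Mat) : Mat := fun i j => Cmul c (A i j).
Definition mmul (N : nat) (A B : Mat) : Mat :=
  fun i j => Csum N (fun k => Cmul (A i k) (B k j)).
Definition adj (A : Mat) : Mat := fun i j => Cconj (A j i).
Definition trace (N : nat) (A : Mat) : C := Csum N (fun i => A i i).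
Definition comm (N : nat) (A B : Mat) : Mat := msub (mmul N A B) (mmul N B A).
Definition diag (l : nat -> R) : Mat :=
  fun i j => if Nat.eqb i j then RtoC (l i) else C0.
(* Kronecker product A (x) B, where B has size dB:
   (A (x) B)_{(a,b),(a',b')} = A_{a a'} B_{b b'} with index a*dB + b *)
Definition kron (dB : nat) (A B : Mat) : Mat :=
  fun i j => Cmul (A (i / dB)%nat (j / dB)%nat) (B (i mod dB)%nat (j mod dB)%nat).

Definition sigma_x : Mat :=
  fun i j => if Nat.eqb i j then C0 else C1.  (* on indices 0,1 *)

Definition hermitian (N : nat) (A : Mat) : Prop := meq N (adj A) A.
Definition skew_hermitian (N : nat) (A : Mat) : Prop :=
  meq N (adj A) (mscale (RtoC (-1)) A).
Definition unitary (N : nat) (U : Mat) : Prop :=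
  meq N (mmul N (adj U) U) mid /\ meq N (mmul N U (adj U)) mid.

Definition qform (N : nat) (A : Mat) (v : Vec) : C :=
  Csum N (fun i => Csum N (fun j => Cmul (Cconj (v i)) (Cmul (A i j) (v j)))).
Definition psd (N : nat) (A : Mat) : Prop :=
  hermitian N A /\ forall v : Vec, 0 <= re (qform N A v).

Definition density (N : nat) (rho : Mat) : Prop :=
  hermitian N rho /\ psd N rho /\ trace N rho = C1.

Definition is_sorted_spectrum (N : nat) (A : Mat) (l : nat -> R) : Prop :=
  (forall k, (S k < N)%nat -> l (S k) <= l k) /\
  exists U, unitary N U /\ meq N A (mmul N (mmul N U (diag l)) (adj U)).

Definition majorised (N : nat) (rho sigma : Mat) : Prop :=
  exists l m, is_sorted_spectrum N rho l /\ is_sorted_spectrum N sigma m /\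
    (forall k, (k <= N)%nat -> Rsum k l <= Rsum k m) /\
    Rsum N l = Rsum N m.

Definition lie_subalgebra (N : nat) (S : Mat -> Prop) : Prop :=
  (forall A B, meq N A B -> S A -> S B) /\
  S mzero /\
  (forall A B, S A -> S B -> S (madd A B)) /\
  (forall (r : R) A, S A -> S (mscale (RtoC r) A)) /\
  (forall A B, S A -> S B -> S (comm N A B)).

Definition lie_generated (N m : nat) (gens : nat -> Mat) (X : Mat) : Prop :=
  forall S, lie_subalgebra N S -> (forall k, (k <= m)%nat -> S (gens k)) -> S X.

Definition in_su (N : nat) (X : Mat) : Prop :=
  skew_hermitian N X /\ trace N X = C0.

Definition ham (m : nat) (H : nat -> Mat) (u : nat -> R) : Mat :=
  fun i j => Cadd (H 0%nat i j)
                  (Csum m (fun k => Cmul (RtoC (u (S k))) (H (S k) i j))).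

(* bit-flip Lindblad operator on the n-th (last) qubit:
   V_b = 1_2^{(n-1)} (x) sigma_x / 2 *)
Definition Vb : Mat := kron 2 mid (mscale (RtoC (1/2)) sigma_x).

Definition lindblad (N : nat) (V rho : Mat) : Mat :=
  let VV := mmul N (adj V) V in
  msub (mscale (RtoC (1/2)) (madd (mmul N VV rho) (mmul N rho VV)))
       (mmul N (mmul N V rho) (adj V)).

Definition generator (N m : nat) (H : nat -> Mat) (u : nat -> R) (g : R)
  (rho : Mat) : Mat :=
  mscale (RtoC (-1))
    (madd (mscale Ci (comm N (ham m H u) rho))
          (mscale (RtoC g) (lindblad N Vb rho))).

Definition flow (N m : nat) (H : nat -> Mat) (u : nat -> R) (g t : R)
  (rho1 rho2 : Mat) : Prop :=
  exists f : R -> Mat,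
    meq N (f 0) rho1 /\ meq N (f t) rho2 /\
    forall s i j, (i < N)%nat -> (j < N)%nat ->
      derivable_pt_lim (fun s' => re (f s' i j)) s (re (generator N m H u g (f s) i j)) /\
      derivable_pt_lim (fun s' => im (f s' i j)) s (im (generator N m H u g (f s) i j)).

(* reachability with piecewise constant controls u(t) in R^m and
   gamma(t) in {0, gamma_star} *)
Inductive reach (N m : nat) (H : nat -> Mat) (gstar : R) : Mat -> Mat -> Prop :=
| reach_refl rho rho' : meq N rho rho' -> reach N m H gstar rho rho'
| reach_step rho1 rho2 rho3 (t : R) (u : nat -> R) (g : R) :
    0 <= t -> (g = 0 \/ g = gstar) ->
    flow N m H u g t rho1 rho2 -> reach N m H gstar rho2 rho3 ->
    reach N m H gstar rho1 rho3.

Definition reach_closure (N m : nat) (H : nat -> Mat) (gstar : R)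
  (rho0 rho : Mat) : Prop :=
  forall eps, 0 < eps -> exists rho', reach N m H gstar rho0 rho' /\
    forall i j, (i < N)%nat -> (j < N)%nat ->
      Rabs (re (rho' i j) - re (rho i j)) < eps /\
      Rabs (im (rho' i j) - im (rho i j)) < eps.

(* Main.v *)
Require Import Defs.
From Stdlib Require Import Reals.
From Stdlib Require Lra Lia Arith Factorial.
From Coquelicot Require Coquelicot.
From mathcomp Require all_boot all_order all_algebra all_fingroup.
From mathcomp Require complex reals ring lra spectral boolp classical_sets Rstruct.
Open Scope R_scope.

(** Let r be a reachability relation generated by linear contractions of the
    Hilbert-Schmidt norm.  Call a superoperator L tangent if A + hLA is reached
    from A up to o(h)|A|, uniformly in A.  Tangent superoperators form a closed
    convex cone, and whenever L is tangent the flow of L stays in the closure of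
    r.

    For r = mixed unitary maps, the cone contains -i ad H and Ad X - 1 with
    X = 1 (x) sigma_x.  Since V_b^2 = 1/4, the generator of the system is
    -i ad H + (gamma/4)(Ad X - 1), so every reachable state is a limit of mixed
    unitary images of rho_0, and Ky Fan's inequalities give majorisation.

    For r = reachability, unitary flows are recurrent (pigeonhole), so the
    directions +-ad(iH_k) are tangent.  The X with +-ad X tangent form a Lie
    algebra, because [X, Y] is the derivative of exp(sX) Y exp(-sX); hence it is
    all of su(N), every unitary conjugation is available, and subtracting the
    drift leaves (gamma/4)(Ad X - 1) tangent.  Its flow mixes A with X A X in any
    proportion up to 1/2.  Conjugating by Hadamard rotations on all but one of
    the blocks {2j, 2j+1} turns X into a transposition times signs, so diagonal
    states undergo a single transfer between two entries, and transfers generate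
    the majorisation order (Hardy-Littlewood-Polya). *)

(** The drift acts at all times, also while the noise is on, so neither the noise alone nor a single
    H_k is available as a control. Passing from states to first-order directions turns the removal
    of the drift into an addition in a cone, once its negative is there, and takes the place of
    product formulas. Uniformity of the error in A lets first-order steps be concatenated at points
    that are known only approximately, and contractivity keeps the accumulated error linear in time.
    The two inclusions are not independent: reachability is contractive because the difference of
    two trajectories under the same controls is again a limit of mixed unitary images. The part of A
    that changes sign under Ad X decays exponentially, so the weight 1/2 is attained only as the
    noise time tends to infinity. Weights up to 1/2 suffice because a transfer never carries the two
    entries past their mean, and exchanging entries is already a unitary conjugation. *)

Module RealFacts.

(** * Scalar analysis: exponential series, rotations and decay *)

Section Analysis.
Import Lra Factorial Coquelicot.

(** Meant for [b n] a coordinate of the n-th iterate of a superoperator on a matrix: [f] is then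
    that coordinate of the solution of the linear equation. Both series belong to the conclusion
    because the derivative [g] must later be identified from the shifted coefficients. *)
Lemma exp_type_series (b : nat -> R) (C K : R) :
  (forall n, Rabs (b n) <= C * K ^ n) ->
  exists f g : R -> R, f 0 = b 0%nat /\ forall t,
    derivable_pt_lim f t (g t) /\
    Un_cv (sum_f_R0 (fun n => b n / INR (fact n) * t ^ n)) (f t) /\
    Un_cv (sum_f_R0 (fun n => b (S n) / INR (fact n) * t ^ n)) (g t).
Proof.
  intros hb.
  set (a := fun n => b n / INR (fact n)).
  assert (rad : CV_radius a = p_infty).
  { destruct (CV_radius_bounded a) as [ub _].
    (* The terms at r are dominated by a multiple of (K r)^n / n!, which is bounded because it tends
       to 0; hence the radius exceeds every real. *)
    assert (hr : forall r : R, Rbar_le r (CV_radius a)).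
    { intros r; apply ub.
      destruct (maj_by_pos _ (exist _ 0 (cv_speed_pow_fact (K * r)))) as [l [l0 hl]].
      exists (Rabs C * l); intros n.
      assert (e : Rabs (a n * r ^ n) = Rabs (b n) * Rabs (r ^ n / INR (fact n))).
      { unfold a; rewrite <- Rabs_mult; f_equal; field; apply INR_fact_neq_0. }
      rewrite e.
      apply Rle_trans with ((C * K ^ n) * Rabs (r ^ n / INR (fact n))).
      { apply Rmult_le_compat_r; [apply Rabs_pos | apply hb]. }
      apply Rle_trans with (Rabs (C * K ^ n) * Rabs (r ^ n / INR (fact n))).
      { apply Rmult_le_compat_r; [apply Rabs_pos | apply Rle_abs]. }
      rewrite Rabs_mult, Rmult_assoc.
      apply Rmult_le_compat_l; [apply Rabs_pos |].
      rewrite <- Rabs_mult.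
      replace (K ^ n * (r ^ n / INR (fact n))) with ((K * r) ^ n / INR (fact n)).
      { apply hl. }
      rewrite Rpow_mult_distr; field; apply INR_fact_neq_0. }
    destruct (CV_radius a) as [x| |]; [|reflexivity|].
    - exfalso; specialize (hr (x + 1)); simpl in hr; lra.
    - exfalso; specialize (hr 0); simpl in hr; exact hr. }
  exists (PSeries a), (PSeries (PS_derive a)); split.
  { rewrite PSeries_0; unfold a; simpl; field. }
  intros t.
  assert (ht : Rbar_lt (Rabs t) (CV_radius a)) by (rewrite rad; exact I).
  split; [|split].
  - apply is_derive_Reals, is_derive_PSeries, ht.
  - exact (proj1 (is_series_Reals _ _) (proj1 (is_pseries_R _ _ _) (PSeries_correct _ _ (CV_radius_inside _ _ ht)))).
  - assert (ht' : Rbar_lt (Rabs t) (CV_radius (PS_derive a))) by (rewrite CV_radius_derive; exact ht).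
    pose proof (proj1 (is_series_Reals _ _) (proj1 (is_pseries_R _ _ _) (PSeries_correct _ _ (CV_radius_inside _ _ ht')))) as h.
    intros e e0; destruct (h e e0) as [n0 hn]; exists n0; intros n nn.
    rewrite (sum_eq _ (fun k => PS_derive a k * t ^ k)).
    { exact (hn n nn). }
    intros k _; unfold PS_derive, a; rewrite fact_simpl, mult_INR; field.
    split; [apply INR_fact_neq_0 | apply not_0_INR; discriminate].
Qed.

(** Real and imaginary parts of exp(i s w)(p + i q), the motion of one matrix entry in the
    eigenbasis of a skew-hermitian generator. *)
Lemma derivable_rotation (p q w t : R) :
  derivable_pt_lim (fun s => cos (s * w) * p - sin (s * w) * q) t
    (- (w * (cos (t * w) * q + sin (t * w) * p))) /\
  derivable_pt_lim (fun s => cos (s * w) * q + sin (s * w) * p) t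
    (w * (cos (t * w) * p - sin (t * w) * q)).
Proof.
  split; apply is_derive_Reals; auto_derive; trivial; ring.
Qed.

Lemma derivable_decay (p q c t : R) :
  derivable_pt_lim (fun s => p + exp (- (s * c)) * q) t (- (c * (exp (- (t * c)) * q))).
Proof.
  apply is_derive_Reals; auto_derive; trivial; ring.
Qed.

Lemma circle_angle (x y : R) : x * x + y * y = 1 -> exists th, cos th = x /\ sin th = y.
Proof.
  intros h.
  assert (hx : -1 <= x <= 1) by nra.
  assert (sq : sqrt (1 - Rsqr x) = Rabs y).
  { rewrite <- sqrt_Rsqr_abs; f_equal; unfold Rsqr; lra. }
  destruct (Rle_dec 0 y) as [hy|hy].
  - exists (acos x); rewrite cos_acos, sin_acos, sq by lra.
    split; [reflexivity | apply Rabs_pos_eq, hy].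
  - exists (- acos x); rewrite cos_neg, sin_neg, cos_acos, sin_acos, sq by lra.
    rewrite Rabs_left by lra; split; lra.
Qed.

Lemma exp_decay_onto (c e : R) : 0 < c -> 0 < e <= 1 -> exists t, 0 <= t /\ exp (- (t * c)) = e.
Proof.
  intros c0 [e0 e1].
  exists (- ln e / c); split.
  - apply Rle_mult_inv_pos; [|exact c0].
    enough (ln e <= 0) by lra.
    rewrite <- ln_1; destruct e1 as [e1 | ->]; [left; apply ln_increasing; lra | right; reflexivity].
  - replace (- (- ln e / c * c)) with (ln e) by (field; lra).
    apply exp_ln, e0.
Qed.

End Analysis.

Import Lra Lia Arith.

(** Flips the last bit of a basis index; [Vb] is half the permutation matrix of this involution. *)
Definition partner (i : nat) : nat := if Nat.even i then S i else pred i.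

Lemma partner_even (k : nat) : partner (2 * k) = (2 * k + 1)%nat.
Proof. unfold partner; rewrite Nat.even_even; lia. Qed.
Lemma partner_odd (k : nat) : partner (2 * k + 1) = (2 * k)%nat.
Proof. unfold partner; rewrite Nat.even_odd; lia. Qed.

Lemma partnerK (i : nat) : partner (partner i) = i.
Proof.
  destruct (Nat.Even_or_Odd i) as [[k ->]|[k ->]];
    rewrite ?partner_even, ?partner_odd, ?partner_even; reflexivity.
Qed.

Lemma even_partner (i : nat) : Nat.even (partner i) = negb (Nat.even i).
Proof.
  destruct (Nat.Even_or_Odd i) as [[k ->]|[k ->]];
    rewrite ?partner_even, ?partner_odd, ?Nat.even_even, ?Nat.even_odd; reflexivity.
Qed.

Lemma partner_lt (n i : nat) : (1 <= n)%nat -> (i < 2 ^ n)%nat -> (partner i < 2 ^ n)%nat.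
Proof.
  intros hn hi; destruct n as [|n]; [lia|]; simpl Nat.pow in *.
  destruct (Nat.Even_or_Odd i) as [[k ->]|[k ->]];
    rewrite ?partner_even, ?partner_odd; lia.
Qed.

Lemma Vb_entry (i j : nat) : Vb i j = if Nat.eqb (partner i) j then RtoC (1 / 2) else C0.
Proof.
  unfold Vb, kron, mid, mscale, sigma_x.
  assert (e0 : forall k, ((2 * k) / 2 = k)%nat /\ ((2 * k) mod 2 = 0)%nat).
  { intros k; rewrite Nat.mul_comm; split; [apply Nat.div_mul | apply Nat.Div0.mod_mul]; lia. }
  assert (e1 : forall k, ((2 * k + 1) / 2 = k)%nat /\ ((2 * k + 1) mod 2 = 1)%nat).
  { intros k; split.
    - rewrite (Nat.mul_comm 2 k), Nat.div_add_l by lia; simpl; lia.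
    - rewrite Nat.add_comm, Nat.mul_comm, Nat.Div0.mod_add; reflexivity. }
  destruct (Nat.Even_or_Odd i) as [[a ->]|[a ->]], (Nat.Even_or_Odd j) as [[b ->]|[b ->]];
    rewrite ?partner_even, ?partner_odd;
    rewrite ?(proj1 (e0 a)), ?(proj2 (e0 a)), ?(proj1 (e1 a)), ?(proj2 (e1 a)),
      ?(proj1 (e0 b)), ?(proj2 (e0 b)), ?(proj1 (e1 b)), ?(proj2 (e1 b)); simpl (Nat.eqb _ _);
    destruct (Nat.eqb_spec a b) as [->|ne];
    match goal with |- context [Nat.eqb ?x ?y] => destruct (Nat.eqb_spec x y) end; try lia;
    unfold Cmul, RtoC, C0, C1; simpl; f_equal; lra.
Qed.

End RealFacts.

Module LieWedge.
Import all_boot all_order all_algebra all_fingroup.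
Import complex reals ring lra spectral boolp classical_sets Rstruct.
Import Order.TTheory GRing.Theory Num.Theory.
Set Implicit Arguments. Unset Strict Implicit. Unset Printing Implicit Defensive.
Local Open Scope ring_scope.
Bind Scope ring_scope with R.
Local Open Scope complex_scope.

(** * Hilbert-Schmidt norm *)

Section RealInduction.
Context {R : realType}.

(** The supremum of the times up to which Q holds satisfies Q by the limit clause, and the step
    clause pushes beyond it unless it is T. This replaces a subdivision of [0, T]: along a
    trajectory the admissible step depends on the current time. *)
Lemma real_induction (Q : R -> Prop) (T : R) : 0 <= T -> Q 0 ->
  (forall t : R, 0 <= t < T -> Q t -> exists2 d : R, 0 < d & forall h : R, 0 < h < d -> Q (t + h)) ->
  (forall t : R, 0 < t <= T -> (forall s : R, 0 <= s < t -> Q s) -> Q t) ->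
  Q T.
Proof.
move=> T0 Q0 step lim.
pose S : set R := fun t => 0 <= t <= T /\ forall s : R, 0 <= s <= t -> Q s.
have S0 : S 0 by split=> [|s /andP[s0 s1]]; [lra | have -> : s = 0 by lra].
have Sub : ubound S T by move=> t [] /andP[].
have hs : has_sup S by split; [exists 0 | exists T].
have sT : sup S <= T by apply: ge_sup => //; exists 0.
have s0 : 0 <= sup S by apply: ub_le_sup => //; exists T.
have Qlt s : 0 <= s < sup S -> Q s.
  move=> /andP[h0 h1]; have [t St st] := @sup_gt R S s (ex_intro _ 0 S0) h1.
  by apply: (proj2 St); rewrite h0 ltW.
have Qs : Q (sup S).
  have [->//|s1] := eqVneq (sup S) 0.
  by apply: lim => //; rewrite sT lt_neqAle eq_sym s1 s0.
have [<-//|sne] := eqVneq (sup S) T.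
have sltT : sup S < T by rewrite lt_neqAle sne.
have [|d d0 hd] := step (sup S) _ Qs; first by rewrite s0.
pose e := Num.min (d / 2) (T - sup S).
have e0 : 0 < e by rewrite lt_min; apply/andP; split; lra.
have ed : e <= d / 2 by rewrite ge_min lexx.
have eT : e <= T - sup S by rewrite ge_min lexx orbT.
suff : S (sup S + e) by move=> /(ub_le_sup (ex_intro _ T Sub)) /=; lra.
split; first lra.
move=> s /andP[h0 h1]; have [h|h|->//] := ltgtP s (sup S).
  by apply: Qlt; rewrite h0.
by rewrite (_ : s = sup S + (s - sup S)); [apply: hd; lra | lra].
Qed.

End RealInduction.

Section Norm.
Context {R : realType} {N : nat}.
Local Notation M := 'M[R[i]]_N.
Implicit Types A B : M.

Definition co A (p : 'I_N * 'I_N * bool) : R :=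
  if p.2 then complex.Re (A p.1.1 p.1.2) else complex.Im (A p.1.1 p.1.2).

Lemma coD A B p : co (A + B) p = co A p + co B p.
Proof. by rewrite /co mxE; case: (A _ _) (B _ _) => a b [c d]; case: p.2. Qed.
Lemma coN A p : co (- A) p = - co A p.
Proof. by rewrite /co mxE; case: (A _ _) => a b; case: p.2. Qed.
Lemma coB A B p : co (A - B) p = co A p - co B p.
Proof. by rewrite coD coN. Qed.
Lemma coZ (r : R) A p : co (r%:C *: A) p = r * co A p.
Proof. by rewrite /co mxE; case: (A _ _) => a b; case: p.2 => /=; ring. Qed.
Lemma co0 p : co 0 p = 0.
Proof. by rewrite /co mxE; case: p.2. Qed.
Lemma coP A B : co A =1 co B -> A = B.
Proof.
move=> h; apply/matrixP=> i j; have := (h (i,j,true), h (i,j,false)).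
by rewrite /co /=; case: (A i j) (B i j) => a b [c d] /= [-> ->].
Qed.

Definition ip A B : R := \sum_p co A p * co B p.
Lemma ipC A B : ip A B = ip B A.
Proof. by apply: eq_bigr => p _; rewrite mulrC. Qed.
Lemma ipDl A B A' : ip (A + B) A' = ip A A' + ip B A'.
Proof. by rewrite /ip -big_split; apply: eq_bigr => p _; rewrite coD mulrDl. Qed.
Lemma ipZl r A B : ip (r%:C *: A) B = r * ip A B.
Proof. by rewrite /ip mulr_sumr; apply: eq_bigr => p _; rewrite coZ mulrA. Qed.
Lemma ipNl A B : ip (- A) B = - ip A B.
Proof. by rewrite /ip -sumrN; apply: eq_bigr => p _; rewrite coN mulNr. Qed.
Lemma ip_ge0 A : 0 <= ip A A.
Proof. by apply: sumr_ge0 => p _; rewrite -expr2 sqr_ge0. Qed.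
Lemma ip_eq0 A : ip A A = 0 -> A = 0.
Proof.
move=> /eqP; rewrite psumr_eq0 => [/allP h|p _]; last by rewrite -expr2 sqr_ge0.
apply: coP => p; rewrite co0; have := h p (mem_index_enum _).
by rewrite /= -expr2 sqrf_eq0 => /eqP.
Qed.

Lemma ip0l B : ip 0 B = 0.
Proof. by rewrite /ip big1 // => p _; rewrite co0 mul0r. Qed.

Lemma ip_cs A B : ip A B ^+ 2 <= ip A A * ip B B.
Proof.
have [/ip_eq0->|c0] := eqVneq (ip B B) 0.
  by rewrite ipC ip0l expr0n mulr_ge0 ?ip_ge0.
have cp : 0 < ip B B by rewrite lt_neqAle eq_sym c0 ip_ge0.
(* This square equals [ip B B] times the difference of the two sides. *)
have := ip_ge0 ((ip B B)%:C *: A - (ip A B)%:C *: B).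
rewrite ipDl ipNl 2!ipZl !(ipC _ (_ - _)) !ipDl !ipNl !ipZl (ipC B A) => h.
by rewrite -subr_ge0 -(pmulr_rge0 _ cp); apply: le_trans h _; rewrite le_eqVlt; apply/orP; left; apply/eqP; ring.
Qed.

Definition nrm A : R := Num.sqrt (ip A A).
Lemma nrm_ge0 A : 0 <= nrm A. Proof. exact: sqrtr_ge0. Qed.
Lemma sqr_nrm A : nrm A ^+ 2 = ip A A. Proof. by rewrite sqr_sqrtr ?ip_ge0. Qed.
Lemma nrm0 : nrm 0 = 0.
Proof. by rewrite /nrm /ip big1 ?sqrtr0 // => p _; rewrite co0 mul0r. Qed.
Lemma nrm_eq0 A : nrm A = 0 -> A = 0.
Proof. by move=> h; apply: ip_eq0; rewrite -sqr_nrm h expr0n. Qed.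
Lemma nrmZ r A : nrm (r%:C *: A) = `|r| * nrm A.
Proof. by rewrite /nrm ipZl ipC ipZl mulrA -expr2 sqrtrM ?sqr_ge0 // sqrtr_sqr. Qed.
Lemma nrmN A : nrm (- A) = nrm A.
Proof. by rewrite /nrm ipNl ipC ipNl opprK. Qed.
Lemma nrmBC A B : nrm (A - B) = nrm (B - A).
Proof. by rewrite -nrmN opprB. Qed.
Lemma ip_le A B : ip A B <= nrm A * nrm B.
Proof.
have h := mulr_ge0 (nrm_ge0 A) (nrm_ge0 B).
apply: le_trans (ler_norm _) _.
by rewrite -(@ler_pXn2r _ 2) ?nnegrE ?normr_ge0 // real_normK ?num_real // exprMn !sqr_nrm ip_cs.
Qed.
Lemma nrmD A B : nrm (A + B) <= nrm A + nrm B.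
Proof.
rewrite -(@ler_pXn2r _ 2) ?nnegrE ?addr_ge0 ?nrm_ge0 // sqr_nrm ipDl !(ipC _ (_ + _)) !ipDl.
have := ip_le A B; rewrite sqrrD !sqr_nrm (ipC B A); lra.
Qed.
Lemma nrmB A B : nrm (A - B) <= nrm A + nrm B.
Proof. by rewrite -(nrmN B) nrmD. Qed.
Lemma nrm_dist A B C : nrm (A - C) <= nrm (A - B) + nrm (B - C).
Proof. by apply: le_trans (nrmD _ _); rewrite addrA subrK. Qed.
Lemma nrm_tri A B : nrm A <= nrm (A - B) + nrm B.
Proof. by apply: le_trans (nrmD _ _); rewrite subrK. Qed.

Lemma co_le A p : `|co A p| <= nrm A.
Proof.
rewrite -sqrtr_sqr ler_wsqrtr // /ip (bigD1 p) //= -expr2 lerDl sumr_ge0 // => q _.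
by rewrite -expr2 sqr_ge0.
Qed.
Lemma nrm_le_co A : nrm A <= \sum_p `|co A p|.
Proof.
have h : 0 <= \sum_p `|co A p| by apply: sumr_ge0.
rewrite -(@ler_pXn2r _ 2) ?nnegrE ?nrm_ge0 // sqr_nrm expr2 mulr_suml.
apply: ler_sum => p _; apply: le_trans (ler_norm _) _; rewrite normrM ler_wpM2l //.
by rewrite (bigD1 p) //= lerDl sumr_ge0.
Qed.
Lemma nrm_le_bound A e : (forall p, `|co A p| <= e) -> nrm A <= #|{: 'I_N * 'I_N * bool}|%:R * e.
Proof.
move=> h; apply: le_trans (nrm_le_co A) _.
by apply: le_trans (ler_sum _ (fun p _ => h p)) _; rewrite sumr_const mulr_natl.
Qed.
(** Some constant is enough to make commutators bounded, so the entries are estimated crudely: each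
    of the N products contributes at most 2|A||B| to either part. *)
Lemma nrmMc A B : nrm (A *m B) <= (#|{: 'I_N * 'I_N * bool}|%:R * (2 * N%:R)) * (nrm A * nrm B).
Proof.
rewrite -mulrA; apply: nrm_le_bound => -[[i j] b].
have hre (X : M) k l : `|complex.Re (X k l)| <= nrm X by exact: (co_le X (k,l,true)).
have him (X : M) k l : `|complex.Im (X k l)| <= nrm X by exact: (co_le X (k,l,false)).
have key (S : 'I_N -> R[i]) : (forall k, `|complex.Re (S k)| <= 2 * (nrm A * nrm B) /\ `|complex.Im (S k)| <= 2 * (nrm A * nrm B)) ->
    `|complex.Re (\sum_k S k)| <= 2 * N%:R * (nrm A * nrm B) /\ `|complex.Im (\sum_k S k)| <= 2 * N%:R * (nrm A * nrm B).
  move=> h; rewrite (_ : 2 * N%:R * _ = \sum_(k < N) (2 * (nrm A * nrm B))); last first.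
    by rewrite sumr_const card_ord -mulr_natl; ring.
  apply: (big_ind2 (fun (x : R[i]) (y : R) => `|complex.Re x| <= y /\ `|complex.Im x| <= y)) => //=.
    by rewrite normr0.
  move=> [a b'] x [c d] y /= [h1 h2] [h3 h4].
  by split; apply: le_trans (ler_normD _ _) _; apply: lerD.
have [|h1 h2] := key (fun k => A i k * B k j).
  move=> k; have := (hre A i k, hre B k j, (him A i k, him B k j)).
  case: (A i k) (B k j) => a b' [c d] /= [[h1 h2] [h3 h4]]; split.
    apply: le_trans (ler_normB _ _) _; rewrite !normrM mulrDl !mul1r.
    by apply: lerD; apply: ler_pM.
  apply: le_trans (ler_normD _ _) _; rewrite !normrM mulrDl !mul1r.
  by apply: lerD; apply: ler_pM.
by rewrite /co /= mxE; case: b.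
Qed.
Lemma nrmM : exists2 K : R, 0 <= K & forall A B, nrm (A *m B) <= K * (nrm A * nrm B).
Proof.
exists (#|{: 'I_N * 'I_N * bool}|%:R * (2 * N%:R)); last exact: nrmMc.
by rewrite !mulr_ge0.
Qed.

End Norm.

(** * Tangent cone of a contractive reachability relation *)

Section Derivative.
Context {R : realType} {N : nat}.
Local Notation M := 'M[R[i]]_N.

Definition has_deriv (phi : R -> M) (t : R) (D : M) := forall e : R, 0 < e ->
  exists2 d : R, 0 < d & forall h : R, `|h| < d ->
    nrm (phi (t + h) - phi t - h%:C *: D) <= e * `|h|.

Lemma has_deriv_cont phi t D : has_deriv phi t D -> forall e : R, 0 < e ->
  exists2 d : R, 0 < d & forall h : R, `|h| < d -> nrm (phi (t + h) - phi t) <= e.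
Proof.
move=> hd e e0; have [d d0 H] := hd 1 ltr01.
have n0 := nrm_ge0 D.
have q0 : 0 < e / (1 + nrm D) by rewrite divr_gt0 //; lra.
exists (Num.min d (e / (1 + nrm D))) => [|h]; first by rewrite lt_min d0.
rewrite lt_min => /andP[h1 h2].
apply: le_trans (nrm_tri _ (h%:C *: D)) _; rewrite nrmZ.
have h3 := H h h1.
have h4 : `|h| * (1 + nrm D) <= e by rewrite -ler_pdivlMr ?ltW //; lra.
lra.
Qed.

(** Real induction with K + e in place of K: the slack e absorbs the remainder of the derivative at
    each step, continuity handles limit times, and e then tends to 0. *)
Lemma mean_value (psi dpsi : R -> M) (T K : R) : 0 <= T ->
  (forall s, has_deriv psi s (dpsi s)) ->
  (forall s, 0 <= s <= T -> nrm (dpsi s) <= K) ->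
  nrm (psi T - psi 0) <= K * T.
Proof.
move=> T0 hd hK.
suff main e : 0 < e -> nrm (psi T - psi 0) <= (K + e) * T.
  apply/ler_addgt0Pr => e e0.
  have q0 : 0 < e / (T + 1) by rewrite divr_gt0 //; lra.
  apply: le_trans (main _ q0) _; rewrite mulrDl lerD2l.
  by rewrite mulrAC ler_pdivrMr; nra.
move=> e0; pose Q t := nrm (psi t - psi 0) <= (K + e) * t.
apply: (@real_induction R Q) => //.
- by rewrite /Q subrr nrm0 mulr0.
- move=> t tT Qt; have [d d0 H] := hd t e e0; exists d => // h /andP[h0 h1].
  have := H h; rewrite gtr0_norm // => /(_ h1) h2.
  rewrite /Q; apply: le_trans (nrm_dist _ (psi t) _) _.
  have h3 : nrm (psi (t + h) - psi t) <= e * h + h * K.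
    apply: le_trans (nrm_tri _ (h%:C *: dpsi t)) _.
    have hKt : nrm (dpsi t) <= K by apply: hK; move: tT; lra.
    by rewrite nrmZ gtr0_norm // lerD // ler_pM2l.
  by rewrite /Q in Qt; nra.
- move=> t /andP[t0 tT] H; rewrite /Q; apply/ler_addgt0Pr => n n0.
  have [d d0 Hd] := has_deriv_cont (hd t) n0.
  pose m := Num.min (d / 2) (t / 2).
  have m0 : 0 < m by rewrite lt_min; apply/andP; split; lra.
  have md : m <= d / 2 by rewrite ge_min lexx.
  have mt : m <= t / 2 by rewrite ge_min lexx orbT.
  have := Hd (- m); rewrite normrN gtr0_norm // nrmBC => /(_ _) h1.
  have {}h1 : nrm (psi t - psi (t - m)) <= n by apply: h1; lra.
  have h2 : Q (t - m) by apply: H; lra.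
  apply: le_trans (nrm_dist _ (psi (t - m)) _) _.
  rewrite /Q in h2.
  have K0 : 0 <= K by apply: le_trans (nrm_ge0 _) (hK 0 _); lra.
  by nra.
Qed.

Lemma has_deriv_sub_lin phi t D (B : M) : has_deriv phi t D ->
  has_deriv (fun s => phi s - s%:C *: B) t (D - B).
Proof.
move=> hd e e0; have [d d0 H] := hd e e0; exists d => // h /H.
congr (_ <= _); congr nrm; apply/matrixP=> i j; rewrite !mxE rmorphD /=; ring.
Qed.

End Derivative.

Section Pigeonhole.
Context {R : realType} {N : nat}.
Local Notation M := 'M[R[i]]_N.

(** The coordinate cube [-K, K] is cut into finitely many cells; among one more term than there are
    cells, two share a cell. *)
Lemma bounded_pigeonhole (a : nat -> M) (K e : R) : (forall n, nrm (a n) <= K) -> 0 < e ->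
  exists n m, (n < m)%N /\ nrm (a m - a n) < e.
Proof.
move=> aK e0.
have K0 : 0 <= K by apply: le_trans (nrm_ge0 _) (aK 0%N).
(* One more than the number of coordinates: cells of side e / c then give a distance of at most (c -
   1) e / c, strictly below e. *)
pose c : R := #|{: 'I_N * 'I_N * bool}|%:R + 1.
have c0 : 0 < c by rewrite ltr_wpDl.
pose d := e / c; have d0 : 0 < d by rewrite divr_gt0.
pose D := Num.truncn (2 * K / d).
pose T := {ffun ('I_N * 'I_N * bool) -> 'I_D.+1}.
pose cell (n : nat) p := Num.truncn ((co (a n) p + K) / d).
have cge n p : 0 <= (co (a n) p + K) / d.
  rewrite divr_ge0 ?(ltW d0) //; have := le_trans (co_le (a n) p) (aK n).
  by rewrite ler_norml => /andP[? _]; lra.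
have cellD n p : (cell n p < D.+1)%N.
  rewrite ltnS; apply: Num.Theory.le_truncn.
  rewrite ler_pM2r ?invr_gt0 //; have := le_trans (co_le (a n) p) (aK n).
  by rewrite ler_norml => /andP[_ ?]; lra.
pose f (n : 'I_(#|T|.+1)) : T := [ffun p => inord (cell n p)].
have /injectivePn[x [y xy fxy]] : ~~ injectiveb f.
  by apply/negP => /injectiveP /leq_card; rewrite card_ord ltnn.
have close (n m : 'I_(#|T|.+1)) : f n = f m -> nrm (a m - a n) < e.
  move=> /ffunP h; apply: le_lt_trans (_ : (c - 1) * d < e); last first.
    by rewrite /d mulrA ltr_pdivrMr // mulrC ltr_pM2l //; lra.
  rewrite /c addrK; apply: nrm_le_bound => p.
  have := h p; rewrite !ffunE => /(congr1 (@nat_of_ord _)); rewrite !inordK ?cellD // => hc.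
  have /andP[a1 a2] := Num.Theory.truncn_itv (cge n p).
  have /andP[b1 b2] := Num.Theory.truncn_itv (cge m p).
  rewrite -/(cell n p) -/(cell m p) hc in a1 a2 b1 b2.
  rewrite !(ler_pdivlMr, ltr_pdivrMr) // in a1 a2 b1 b2.
  rewrite -natr1 in a2 b2; rewrite coB.
  by rewrite ler_norml; apply/andP; split; nra.
have [lt|lt|/val_inj eq] := ltngtP x y.
- by exists x, y; split => //; apply: close.
- by exists y, x; split => //; apply: close.
- by rewrite eq eqxx in xy.
Qed.

End Pigeonhole.

Section Reach.
Context {R : realType} {N : nat}.
Local Notation M := 'M[R[i]]_N.
Implicit Types (A B : M) (L : M -> M).

Record blin L : Prop := BLin {
  blinD : forall A B, L (A + B) = L A + L B;
  blinZ : forall (r : R) A, L (r%:C *: A) = r%:C *: L A;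
  blin_bound : exists2 K : R, 0 <= K & forall A, nrm (L A) <= K * nrm A }.

Lemma blinN L A : blin L -> L (- A) = - L A.
Proof.
by move=> bL; rewrite -[- A]scaleN1r -[-1]/(-1%:C) -rmorphN (blinZ bL) rmorphN scaleN1r.
Qed.
Lemma blinB L A B : blin L -> L (A - B) = L A - L B.
Proof. by move=> bL; rewrite (blinD bL) blinN. Qed.

(** [r_follow] encodes that runs are linear contractions without naming the maps: a run from A can
    be copied from A', and the gap does not grow. Copying from 0 with [r_zero] makes the norm
    nonincreasing along r. *)
Record contractive (r : M -> M -> Prop) : Prop := Contractive {
  r_refl : forall A, r A A;
  r_trans : forall A B C, r A B -> r B C -> r A C;
  r_follow : forall A B A', r A B -> exists2 B', r A' B' & nrm (B' - B) <= nrm (A' - A);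
  r_zero : forall B, r 0 B -> B = 0 }.

Definition cl (r : M -> M -> Prop) A B := forall e : R, 0 < e ->
  exists2 B', r A B' & nrm (B' - B) < e.

Section Fixr.
Variable r : M -> M -> Prop.
Hypothesis cr : contractive r.

Lemma cl_of A B : r A B -> cl r A B.
Proof. by move=> h e e0; exists B => //; rewrite subrr nrm0. Qed.

Lemma cl_refl A : cl r A A.
Proof. exact/cl_of/(r_refl cr). Qed.

(** The second leg starts at B, while only some B' near B is reached; [r_follow] copies the leg from
    B'. *)
Lemma cl_trans A B C : cl r A B -> cl r B C -> cl r A C.
Proof.
move=> h1 h2 e e0; have e20 : 0 < e / 2 by lra.
have [B' rB' hB'] := h1 _ e20; have [C' rC' hC'] := h2 _ e20.
have [C'' rC'' hC''] := r_follow cr B' rC'.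
exists C''; first exact: (r_trans cr) rC''.
by have := nrm_dist C'' C' C; lra.
Qed.

Lemma cl_closed A B : (forall e : R, 0 < e -> exists2 B', cl r A B' & nrm (B' - B) < e) -> cl r A B.
Proof.
move=> h e e0; have e20 : 0 < e / 2 by lra.
have [B' h1 h2] := h _ e20; have [B'' h3 h4] := h1 _ e20.
by exists B'' => //; have := nrm_dist B'' B' B; lra.
Qed.

Lemma cl_follow A B A' (n : R) : 0 < n -> cl r A B ->
  exists2 B', r A' B' & nrm (B' - B) <= nrm (A' - A) + n.
Proof.
move=> n0 h; have [B1 h1 h2] := h _ n0; have [B' h3 h4] := r_follow cr A' h1.
by exists B' => //; have := nrm_dist B' B1 B; lra.
Qed.

Lemma r_nrm A B : r A B -> nrm B <= nrm A.
Proof.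
move=> h; have [B' /(r_zero cr)-> ] := r_follow cr 0 h.
by rewrite !sub0r !nrmN.
Qed.

Lemma cl_nrm A B : cl r A B -> nrm B <= nrm A.
Proof.
move=> h; apply/ler_addgt0Pr => e e0; have [B' /r_nrm h1 h2] := h _ e0.
by have := nrm_tri B B'; rewrite nrmBC; lra.
Qed.

Definition tangent L := forall e : R, 0 < e -> exists2 d : R, 0 < d &
  forall h : R, 0 < h < d -> forall A, exists2 B, cl r A B & nrm (B - (A + h%:C *: L A)) <= e * h * nrm A.

Lemma tangent_ext L L' : L =1 L' -> tangent L -> tangent L'.
Proof.
move=> eL t e /t[d d0 H]; exists d => // h /H{}H A; have [B ? ?] := H A.
by exists B => //; rewrite -eL.
Qed.

(** A step along L1 to B1, then one along L2 from B1. Evaluating L2 at B1 instead of A costs h|L2(B1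
    - A)| = O(h^2)|A|. Uniformity allows a step from the unknown point B1, whose norm is at most
    |A|. *)
Lemma tangentD L1 L2 : blin L1 -> blin L2 -> tangent L1 -> tangent L2 ->
  tangent (fun A => L1 A + L2 A).
Proof.
move=> bL1 bL2 t1 t2 e e0.
have [K1 K10 hK1] := blin_bound bL1; have [K2 K20 hK2] := blin_bound bL2.
pose n := Num.min 1 (e / 4).
have n0 : 0 < n by rewrite lt_min ltr01; lra.
have n1 : n <= 1 by rewrite ge_min lexx.
have ne : n <= e / 4 by rewrite ge_min lexx orbT.
have [d1 d10 H1] := t1 n n0; have [d2 d20 H2] := t2 n n0.
have KK : 0 <= K2 * (K1 + 1) by rewrite mulr_ge0 //; lra.
(* Below this bound the quadratic term h^2 K2 (K1 + 1) |A| is at most (e / 4) h |A|; the two step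
   errors contribute e / 4 each. *)
have q0 : 0 < e / (4 * (K2 * (K1 + 1) + 1)) by rewrite divr_gt0 //; nra.
exists (Num.min (Num.min d1 d2) (e / (4 * (K2 * (K1 + 1) + 1)))) => [|h].
  by rewrite !lt_min d10 d20.
rewrite !lt_min => /andP[h0 /andP[/andP[hd1 hd2] hq]] A.
have [B1 c1 b1] : exists2 B, cl r A B & nrm (B - (A + h%:C *: L1 A)) <= n * h * nrm A.
  by apply: H1; rewrite h0.
have [B2 c2 b2] : exists2 B, cl r B1 B & nrm (B - (B1 + h%:C *: L2 B1)) <= n * h * nrm B1.
  by apply: H2; rewrite h0.
exists B2; first exact: cl_trans c2.
have nA := nrm_ge0 A.
have nB1 := cl_nrm c1.
have e1 : nrm (B1 - A) <= h * (K1 + 1) * nrm A.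
  have -> : B1 - A = B1 - (A + h%:C *: L1 A) + h%:C *: L1 A.
    by apply/matrixP=> i j; rewrite !mxE; ring.
  apply: le_trans (nrmD _ _) _; rewrite nrmZ gtr0_norm //.
  have h1 : h * nrm (L1 A) <= h * (K1 * nrm A) by rewrite ler_pM2l.
  have h2 : n * (h * nrm A) <= 1 * (h * nrm A) by rewrite ler_wpM2r // mulr_ge0 // ltW.
  lra.
have -> : B2 - (A + h%:C *: (L1 A + L2 A)) =
   (B2 - (B1 + h%:C *: L2 B1)) + (B1 - (A + h%:C *: L1 A)) + h%:C *: (L2 (B1 - A)).
  by rewrite (blinB B1 A bL2); apply/matrixP=> i j; rewrite !mxE; ring.
apply: le_trans (nrmD _ _) _; apply: le_trans (lerD (nrmD _ _) (lexx _)) _.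
rewrite nrmZ gtr0_norm //.
have e2 : h * nrm (L2 (B1 - A)) <= h * (K2 * (h * (K1 + 1) * nrm A)).
  by rewrite ler_pM2l //; apply: le_trans (hK2 _) _; rewrite ler_wpM2l.
have e3 : n * h * nrm B1 <= e / 4 * (h * nrm A).
  rewrite -mulrA; apply: ler_pM => //; [exact: ltW | | by rewrite ler_pM2l].
  by rewrite mulr_ge0 ?nrm_ge0 // ltW.
have e4 : n * h * nrm A <= e / 4 * (h * nrm A).
  by rewrite -mulrA ler_wpM2r // mulr_ge0 // ltW.
have e5 : h * (K2 * (h * (K1 + 1) * nrm A)) <= e / 4 * (h * nrm A).
  have -> : h * (K2 * (h * (K1 + 1) * nrm A)) = (h * (K2 * (K1 + 1))) * (h * nrm A) by ring.
  apply: ler_wpM2r; first by rewrite mulr_ge0 // ltW.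
  rewrite ltr_pdivlMr in hq; last lra.
  by lra.
have : 0 <= h * nrm A by rewrite mulr_ge0 // ltW.
by nra.
Qed.

Lemma tangentZ c L : 0 <= c -> tangent L -> tangent (fun A => c%:C *: L A).
Proof.
move=> c0 t e e0; have [->|cn] := eqVneq c 0.
  exists 1 => // h /andP[h0 _] A; exists A; first exact: cl_refl.
  by rewrite scale0r scaler0 addr0 subrr nrm0 !mulr_ge0 ?nrm_ge0 // ltW.
have cp : 0 < c by rewrite lt_neqAle eq_sym cn.
have [d d0 H] := t (e / c) (divr_gt0 e0 cp).
exists (d / c) => [|h /andP[h0 hd] A]; first exact: divr_gt0.
have [|B cB hB] := H (c * h) _ A.
  by rewrite mulr_gt0 //= mulrC -ltr_pdivlMr.
exists B => //; rewrite scalerA -rmorphM mulrC.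
by move: hB; rewrite !mulrA divfK // gt_eqF.
Qed.

Lemma tangent_closed L :
  (forall e : R, 0 < e -> exists2 L', tangent L' & forall A, nrm (L' A - L A) <= e * nrm A) ->
  tangent L.
Proof.
move=> H e e0; have e20 : 0 < e / 2 by lra.
have [L' t' hL'] := H _ e20; have [d d0 Hd] := t' _ e20.
exists d => // h hh A; have [B cB hB] := Hd h hh A; exists B => //.
have -> : B - (A + h%:C *: L A) = B - (A + h%:C *: L' A) + h%:C *: (L' A - L A).
  by apply/matrixP=> i j; rewrite !mxE; ring.
apply: le_trans (nrmD _ _) _; rewrite nrmZ.
move: hh => /andP[h0 _]; rewrite gtr0_norm //.
have : h * nrm (L' A - L A) <= h * (e / 2 * nrm A) by rewrite ler_pM2l.
lra.
Qed.

(** Real induction along the trajectory with error e t: of each step's budget e h, half pays for the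
    derivative of [phi] and half for tangency, and contractivity carries over the earlier error
    unchanged. *)
Lemma tangent_flow L (phi : R -> M) (T : R) : 0 <= T -> tangent L ->
  (forall t, has_deriv phi t (L (phi t))) -> cl r (phi 0) (phi T).
Proof.
move=> T0 tL hd.
suff main (e : R) : 0 < e -> forall n : R, 0 < n -> exists2 B, r (phi 0) B & nrm (B - phi T) <= e * T + n.
  move=> e e0.
  have q0 : 0 < e / (4 * (T + 1)) by rewrite divr_gt0 //; lra.
  have e40 : 0 < e / 4 by lra.
  have [B rB hB] := main _ q0 _ e40; exists B => //.
  apply: le_lt_trans hB _.
  have : e / (4 * (T + 1)) * T <= e / 4 by rewrite mulrAC ler_pdivrMr; nra.
  lra.
move=> e0.
(* The extra slack n pays for replacing closure points by reached ones. It is quantified inside Q,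
   so halving it at each step accumulates nothing. *)
pose Q (t : R) := forall n : R, 0 < n -> exists2 B, r (phi 0) B & nrm (B - phi t) <= e * t + n.
apply: (@real_induction R Q) => //.
- move=> n n0; exists (phi 0); first exact: (r_refl cr).
  by rewrite subrr nrm0 mulr0 add0r ltW.
- move=> t tT Qt; have e20 : 0 < e / 2 by lra.
  have [d1 d10 H1] := hd t _ e20.
  have nA := nrm_ge0 (phi t).
  have q0 : 0 < e / (2 * (nrm (phi t) + 1)) by rewrite divr_gt0 //; lra.
  have [d2 d20 H2] := tL _ q0.
  exists (Num.min d1 d2) => [|h]; first by rewrite lt_min d10.
  rewrite lt_min => /andP[h0 /andP[hd1 hd2]] n n0.
  have n20 : 0 < n / 2 by lra.
  have [|C cC hC] := H2 h _ (phi t); first by rewrite h0.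
  have [B rB hB] := Qt _ n20.
  have [C' rC' hC'] := cl_follow B n20 cC.
  exists C'; first exact: (r_trans cr) rC'.
  have := H1 h; rewrite gtr0_norm // => /(_ hd1) h1.
  have h2 : e / (2 * (nrm (phi t) + 1)) * h * nrm (phi t) <= e / 2 * h.
    rewrite mulrAC; apply: ler_wpM2r; first exact: ltW.
    by rewrite mulrAC ler_pdivrMr; nra.
  have t1 := nrm_dist C' C (phi (t + h)).
  have t2 := nrm_dist C (phi t + h%:C *: L (phi t)) (phi (t + h)).
  have t3 : nrm (phi t + h%:C *: L (phi t) - phi (t + h)) <= e / 2 * h.
    by rewrite nrmBC opprD addrA.
  by lra.
- move=> t /andP[t0 tT] H n n0; have n20 : 0 < n / 2 by lra.
  have [d d0 Hd] := has_deriv_cont (hd t) n20.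
  pose m := Num.min (d / 2) (t / 2).
  have m0 : 0 < m by rewrite lt_min; apply/andP; split; lra.
  have md : m <= d / 2 by rewrite ge_min lexx.
  have mt : m <= t / 2 by rewrite ge_min lexx orbT.
  have := Hd (- m); rewrite normrN gtr0_norm // => /(_ _) h1.
  have {}h1 : nrm (phi (t - m) - phi t) <= n / 2 by apply: h1; lra.
  have [|B rB hB] := H (t - m) _ _ n20; first lra.
  exists B => //; have := nrm_dist B (phi (t - m)) (phi t); nra.
Qed.

(** The mean value inequality is used twice: |phi s - A| <= K |A| h, and then phi s - s L A has
    derivative L(phi s - A), which bounds the remainder by K^2 h^2 |A|. Monotonicity of the norm
    along [cl] makes both bounds uniform in A. *)
Lemma flow_tangent L : blin L ->
  (forall A, exists phi : R -> M, [/\ phi 0 = A, forall t, has_deriv phi t (L (phi t)) &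
     forall t, 0 <= t -> cl r A (phi t)]) -> tangent L.
Proof.
move=> bL H e e0; have [K K0 hK] := blin_bound bL.
have q0 : 0 < e / (K ^+ 2 + 1) by rewrite divr_gt0 // ltr_wpDl // sqr_ge0.
exists (e / (K ^+ 2 + 1)) => // h /andP[h0 h1] A.
have [phi [phi0 dphi cphi]] := H A.
exists (phi h); first by apply: cphi; exact: ltW.
have nA := nrm_ge0 A.
have step1 s : 0 <= s <= h -> nrm (phi s - A) <= K * nrm A * h.
  move=> /andP[s0 sh]; rewrite -phi0; apply: le_trans (_ : K * nrm A * s <= _).
    apply: (mean_value s0 dphi) => t /andP[t0 _].
    by apply: le_trans (hK _) _; apply: ler_wpM2l => //; apply: cl_nrm; exact: cphi.
  by rewrite phi0 ler_wpM2l // mulr_ge0.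
have step2 : nrm ((phi h - h%:C *: L A) - (phi 0 - 0%:C *: L A)) <= K * (K * nrm A * h) * h.
  apply: (mean_value (ltW h0) (fun s => has_deriv_sub_lin (L A) (dphi s))) => s hs.
  by rewrite -(blinB (phi s) A bL); apply: le_trans (hK _) _; rewrite ler_wpM2l // step1.
have -> : phi h - (A + h%:C *: L A) = (phi h - h%:C *: L A) - (phi 0 - 0%:C *: L A).
  by rewrite phi0 scale0r; apply/matrixP=> i j; rewrite !mxE; ring.
apply: le_trans step2 _.
have -> : K * (K * nrm A * h) * h = (h * K ^+ 2) * (h * nrm A) by ring.
rewrite -(mulrA e); apply: ler_wpM2r; first by rewrite mulr_ge0 // ltW.
move: h1; rewrite ltr_pdivlMr; last by rewrite ltr_wpDl // sqr_ge0.
by move=> h1; lra.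
Qed.

(** For t < 0 the orbit at the forward times n|t| stays bounded, so its terms n < m are close for
    some n, m. Shifting both back isometrically by n + 1 steps puts the forward time (m - n - 1)|t|
    close to the time t. *)
Lemma recurrence (V : R -> M -> M) :
  (forall A, V 0 A = A) -> (forall s t A, V (s + t) A = V s (V t A)) ->
  (forall t A B, nrm (V t A - V t B) = nrm (A - B)) ->
  (forall t, V t 0 = 0) ->
  (forall t A, 0 <= t -> cl r A (V t A)) -> forall t A, cl r A (V t A).
Proof.
move=> V0 VD Viso Vz Vr t A; have [t0|t0] := leP 0 t; first exact: Vr.
apply: cl_closed => e e0.
have [|n [m [nm hnm]]] := @bounded_pigeonhole R N (fun n => V (n%:R * - t) A) (nrm A) e _ e0.
  by move=> n; have := Viso (n%:R * - t) A 0; rewrite Vz !subr0 => ->.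
exists (V ((m - n.+1)%:R * - t) A); first by apply: Vr; rewrite mulr_ge0 // oppr_ge0 ltW.
have := Viso (n.+1%:R * - t) (V ((m - n.+1)%:R * - t) A) (V t A).
rewrite -!VD -mulrDl -natrD subnKC // => <-.
rewrite -addn1 natrD mulrDl mul1r subrK //.
Qed.

End Fixr.
End Reach.

(** * Mixed unitary maps and Ky Fan functionals *)

Section Unitary.
Context {R : realType} {N : nat}.
Local Notation M := 'M[R[i]]_N.
Implicit Types (A B U : M).

Definition dag A : M := map_mx conjc A^T.

Lemma dagE A i j : dag A i j = conjc (A j i). Proof. by rewrite !mxE. Qed.
Lemma dagK A : dag (dag A) = A.
Proof. by apply/matrixP=> i j; rewrite !dagE conjcK. Qed.
Lemma dagM A B : dag (A *m B) = dag B *m dag A.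
Proof. by rewrite /dag trmx_mul map_mxM. Qed.
Lemma dagD A B : dag (A + B) = dag A + dag B.
Proof. by rewrite /dag raddfD /= map_mxD. Qed.
Lemma dagN A : dag (- A) = - dag A.
Proof. by apply/matrixP=> i j; rewrite !(dagE, mxE) rmorphN. Qed.
Lemma dagB A B : dag (A - B) = dag A - dag B.
Proof. by rewrite dagD dagN. Qed.
Lemma dagZ c A : dag (c *: A) = conjc c *: dag A.
Proof. by apply/matrixP=> i j; rewrite !(dagE, mxE) rmorphM. Qed.
Lemma dagZr (r : R) A : dag (r%:C *: A) = r%:C *: dag A.
Proof. by rewrite dagZ conjc_real. Qed.
Lemma dag1 : dag 1%:M = 1%:M.
Proof. by rewrite /dag trmx1 map_mx1. Qed.

Lemma dag0 : dag 0 = 0.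
Proof. by apply/matrixP=> i j; rewrite dagE !mxE conjc0. Qed.

Definition is_unitary U := U *m dag U = 1%:M.
Lemma unitaryV U : is_unitary U -> dag U *m U = 1%:M.
Proof. exact: mulmx1C. Qed.
Lemma unitary_dag U : is_unitary U -> is_unitary (dag U).
Proof. by rewrite /is_unitary dagK; exact: unitaryV. Qed.
Lemma unitaryM U V : is_unitary U -> is_unitary V -> is_unitary (U *m V).
Proof.
by rewrite /is_unitary => hU hV; rewrite dagM mulmxA -(mulmxA U) hV mulmx1.
Qed.
Lemma unitary1 : is_unitary 1%:M. Proof. by rewrite /is_unitary dag1 mulmx1. Qed.

Definition conjU U A := U *m A *m dag U.
Lemma conjUD U A B : conjU U (A + B) = conjU U A + conjU U B.
Proof. by rewrite /conjU mulmxDr mulmxDl. Qed.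
Lemma conjUN U A : conjU U (- A) = - conjU U A.
Proof. by rewrite /conjU mulmxN mulNmx. Qed.
Lemma conjUB U A B : conjU U (A - B) = conjU U A - conjU U B.
Proof. by rewrite conjUD conjUN. Qed.
Lemma conjUZ U c A : conjU U (c *: A) = c *: conjU U A.
Proof. by rewrite /conjU -scalemxAr -scalemxAl. Qed.
Lemma conjUM U V A : conjU (U *m V) A = conjU U (conjU V A).
Proof. by rewrite /conjU dagM !mulmxA. Qed.
Lemma conjU1 A : conjU 1%:M A = A.
Proof. by rewrite /conjU dag1 mul1mx mulmx1. Qed.
Lemma conjUK U A : is_unitary U -> conjU (dag U) (conjU U A) = A.
Proof. by move=> hU; rewrite -conjUM (unitaryV hU) conjU1. Qed.
Lemma conjUVK U A : is_unitary U -> conjU U (conjU (dag U) A) = A.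
Proof. by move=> hU; rewrite -conjUM hU conjU1. Qed.
Lemma conjU_mul U A B : is_unitary U -> conjU U (A *m B) = conjU U A *m conjU U B.
Proof.
by move=> hU; rewrite /conjU !mulmxA -[_ *m dag U *m U]mulmxA (unitaryV hU) mulmx1.
Qed.
Lemma dag_conjU U A : dag (conjU U A) = conjU U (dag A).
Proof. by rewrite /conjU !dagM dagK mulmxA. Qed.
Lemma conjU_id U : is_unitary U -> conjU U 1%:M = 1%:M.
Proof. by move=> hU; rewrite /conjU mulmx1. Qed.

Lemma ReD (x y : R[i]) : complex.Re (x + y) = complex.Re x + complex.Re y.
Proof. by case: x y => a b [c d]. Qed.
Lemma Re_sum (I : Type) (s : seq I) (P : pred I) (F : I -> R[i]) :
  complex.Re (\sum_(i <- s | P i) F i) = \sum_(i <- s | P i) complex.Re (F i).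
Proof. by apply: (big_morph _ ReD). Qed.
Lemma ip_trace A B : ip A B = complex.Re (\tr (A *m dag B)).
Proof.
rewrite /mxtrace Re_sum /ip.
under [RHS]eq_bigr => i _ do rewrite mxE Re_sum.
rewrite pair_bigA /= -(pair_bigA _ (fun p (b : bool) => co A (p, b) * co B (p, b))) /=.
apply: eq_bigr => -[i j] _; rewrite big_bool /co /= dagE.
by case: (A i j) (B i j) => a b [c d] /=; ring.
Qed.

Lemma nrm_conjU U A : is_unitary U -> nrm (conjU U A) = nrm A.
Proof.
move=> hU; rewrite /nrm !ip_trace dag_conjU -conjU_mul // /conjU.
by rewrite (mxtrace_mulC (U *m _)) !mulmxA (unitaryV hU) mul1mx.
Qed.

Lemma blin_conjU U : is_unitary U -> blin (conjU U).
Proof.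
move=> hU; split=> [A B|r A|]; [exact: conjUD | exact: conjUZ |].
by exists 1 => // A; rewrite nrm_conjU // mul1r.
Qed.

Definition ad (X A : M) := X *m A - A *m X.

Lemma blin_ad X : blin (ad X).
Proof.
split=> [A B|r A|]; rewrite /ad.
- by rewrite mulmxDr mulmxDl; apply/matrixP=> i j; rewrite !mxE; ring.
- by rewrite -scalemxAr -scalemxAl scalerBr.
have [K K0 hK] := @nrmM R N; exists (K * nrm X *+ 2).
  by rewrite mulrn_wge0 // mulr_ge0 // nrm_ge0.
move=> A; apply: le_trans (nrmB _ _) _; rewrite mulr2n mulrDl -mulrA.
by apply: lerD; rewrite ?hK // (mulrC (nrm X)).
Qed.

Lemma blin_add (L1 L2 : M -> M) : blin L1 -> blin L2 -> blin (fun A => L1 A + L2 A).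
Proof.
move=> b1 b2; split=> [A B|r A|].
- by rewrite (blinD b1) (blinD b2) addrACA.
- by rewrite (blinZ b1) (blinZ b2) scalerDr.
have [K1 K10 h1] := blin_bound b1; have [K2 K20 h2] := blin_bound b2.
exists (K1 + K2); first exact: addr_ge0.
by move=> A; apply: le_trans (nrmD _ _) _; rewrite mulrDl lerD.
Qed.

Lemma blin_scale (c : R) (L : M -> M) : blin L -> blin (fun A => c%:C *: L A).
Proof.
move=> b; split=> [A B|r A|].
- by rewrite (blinD b) scalerDr.
- by rewrite (blinZ b) !scalerA mulrC.
have [K K0 h] := blin_bound b.
exists (`|c| * K); first exact: mulr_ge0.
by move=> A; rewrite nrmZ -mulrA ler_wpM2l.
Qed.

Lemma blin_ext (L L' : M -> M) : L =1 L' -> blin L -> blin L'.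
Proof.
move=> e b; split=> [A B|r A|]; rewrite -?e; [exact: (blinD b) | exact: (blinZ b) |].
by have [K K0 h] := blin_bound b; exists K => // A; rewrite -e.
Qed.

Lemma blin_id : blin (fun A : M => A).
Proof. by split=> //; exists 1 => // A; rewrite mul1r. Qed.

Definition flip X A := conjU X A - A.
Lemma blin_flip X : is_unitary X -> blin (flip X).
Proof.
move=> hX; apply: blin_ext (blin_add (blin_conjU hX) (blin_scale (-1) blin_id)) => A.
by rewrite /flip rmorphN scaleN1r.
Qed.

(** Generated by binary mixtures and composition instead of finite convex sums, so that each
    invariant below is an induction with three cases. *)
Inductive mixed_unitary : (M -> M) -> Prop :=
| mix_conj U : is_unitary U -> mixed_unitary (conjU U)
| mix_convex (t : R) F G : 0 <= t <= 1 -> mixed_unitary F -> mixed_unitary G ->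
    mixed_unitary (fun A => (1 - t)%:C *: F A + t%:C *: G A)
| mix_comp F G : mixed_unitary F -> mixed_unitary G -> mixed_unitary (fun A => G (F A)).

Lemma mixD F : mixed_unitary F -> forall A B, F (A - B) = F A - F B.
Proof.
elim=> {F} [U hU A B|t F G ht _ hF _ hG A B|F G _ hF _ hG A B].
- exact: conjUB.
- by rewrite hF hG; apply/matrixP=> i j; rewrite !mxE; ring.
- by rewrite hF hG.
Qed.

Lemma mix_nrm F : mixed_unitary F -> forall A, nrm (F A) <= nrm A.
Proof.
elim=> {F} [U hU A|t F G /andP[t0 t1] _ hF _ hG A|F G _ hF _ hG A].
- by rewrite nrm_conjU.
- apply: le_trans (nrmD _ _) _; rewrite !nrmZ !ger0_norm //; last lra.
  have := hF A; have := hG A; nra.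
- exact: le_trans (hG _) (hF _).
Qed.

Definition mix_rel A B := exists2 F, mixed_unitary F & B = F A.

Lemma contractive_mix : contractive mix_rel.
Proof.
split.
- by move=> A; exists (conjU 1%:M); [exact/mix_conj/unitary1 | rewrite conjU1].
- move=> A B C [F hF ->] [G hG ->]; exists (fun A => G (F A)) => //; exact: mix_comp.
- move=> A B A' [F hF ->]; exists (F A'); first by exists F.
  by rewrite -mixD // mix_nrm.
- move=> B [F hF ->]; apply: nrm_eq0; apply/eqP; rewrite eq_le nrm_ge0 andbT.
  by rewrite -[leRHS](@nrm0 R N) mix_nrm.
Qed.

(** For 0 < h < 1 the first-order step A + h(X A X^* - A) is itself a mixture of A and its
    conjugate, so the error vanishes. *)
Lemma tangent_mix_flip X : is_unitary X -> tangent mix_rel (flip X).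
Proof.
move=> hX e e0; exists 1 => // h /andP[h0 h1] A.
exists ((1 - h)%:C *: conjU 1%:M A + h%:C *: conjU X A).
  apply: cl_of; exists (fun A => (1 - h)%:C *: conjU 1%:M A + h%:C *: conjU X A) => //.
  by apply: mix_convex; [rewrite !ltW | exact/mix_conj/unitary1 | exact: mix_conj].
rewrite conjU1 (_ : _ - _ = 0) ?nrm0; last first.
  by rewrite /flip; apply/matrixP=> i j; rewrite !mxE rmorphB rmorph1; ring.
by rewrite !mulr_ge0 ?nrm_ge0 // ltW.
Qed.

(** For hermitian A the maximum over unitary W is the sum of the k largest eigenvalues. This turns
    majorisation into bounds on functionals that are linear in A. *)
Definition kyfan (k : nat) (W A : M) : R := \sum_(i < N | (i < k)%N) complex.Re (conjU W A i i).

Lemma kyfanD k W A B : kyfan k W (A + B) = kyfan k W A + kyfan k W B.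
Proof.
by rewrite /kyfan -big_split; apply: eq_bigr => i _; rewrite conjUD mxE ReD.
Qed.
Lemma kyfanZ k W (r : R) A : kyfan k W (r%:C *: A) = r * kyfan k W A.
Proof.
rewrite /kyfan mulr_sumr; apply: eq_bigr => i _; rewrite conjUZ mxE.
by case: (conjU _ _ _ _) => a b /=; ring.
Qed.
Lemma kyfanN k W A : kyfan k W (- A) = - kyfan k W A.
Proof.
rewrite /kyfan -sumrN; apply: eq_bigr => i _; rewrite conjUN mxE.
by case: (conjU _ _ _ _).
Qed.
Lemma kyfan_conj k W U A : kyfan k W (conjU U A) = kyfan k (W *m U) A.
Proof. by rewrite /kyfan conjUM. Qed.
Lemma kyfan_le k W A : is_unitary W -> kyfan k W A <= N%:R * nrm A.
Proof.
move=> hW; rewrite /kyfan big_mkcond /= -[X in X%:R]card_ord mulr_natl -sumr_const.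
apply: ler_sum => i _; case: ifP => _; last exact: nrm_ge0.
apply: le_trans (ler_norm _) _; rewrite -(nrm_conjU A hW).
exact: (co_le (conjU W A) (i, i, true)).
Qed.

(** Quantifying over all unitary W makes the bound stable under conjugation, which only replaces W
    by W U; mixtures follow by linearity. *)
Lemma mix_kyfan F (c : R) k : mixed_unitary F -> forall A,
  (forall W, is_unitary W -> kyfan k W A <= c) -> forall W, is_unitary W -> kyfan k W (F A) <= c.
Proof.
elim=> {F} [U hU A H W hW|t F G /andP[t0 t1] _ hF _ hG A H W hW|F G _ hF _ hG A H].
- by rewrite kyfan_conj; apply: H; exact: unitaryM.
- rewrite kyfanD !kyfanZ; have := hF A H W hW; have := hG A H W hW; nra.
- exact/hG/hF.
Qed.

Lemma mix_dag F : mixed_unitary F -> forall A, dag (F A) = F (dag A).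
Proof.
elim=> {F} [U hU A|t F G ht _ hF _ hG A|F G _ hF _ hG A].
- exact: dag_conjU.
- by rewrite dagD !dagZr hF hG.
- by rewrite hG hF.
Qed.

Lemma mix_trace F : mixed_unitary F -> forall A, \tr (F A) = \tr A.
Proof.
elim=> {F} [U hU A|t F G ht _ hF _ hG A|F G _ hF _ hG A].
- by rewrite /conjU (mxtrace_mulC (U *m _)) mulmxA (unitaryV hU) mul1mx.
- by rewrite mxtraceD !mxtraceZ hF hG -mulrDl -rmorphD subrK rmorph1 mul1r.
- by rewrite hG hF.
Qed.

Lemma cl_mix_kyfan A B (c : R) k : cl mix_rel A B ->
  (forall W, is_unitary W -> kyfan k W A <= c) -> forall W, is_unitary W -> kyfan k W B <= c.
Proof.
move=> cAB H W hW; apply/ler_addgt0Pr => e e0.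
have q0 : 0 < e / (N%:R + 1) by rewrite divr_gt0 // ltr_wpDl.
have [B' [F hF ->] hB] := cAB _ q0.
have := mix_kyfan hF H hW; have := kyfan_le k (B - F A) hW.
rewrite kyfanD kyfanN nrmBC => h1 h2.
have : N%:R * nrm (F A - B) <= e.
  have : (N%:R + 1) * nrm (F A - B) <= e by rewrite mulrC -ler_pdivlMr ?ltW // ltr_wpDl.
  have := nrm_ge0 (F A - B); lra.
lra.
Qed.

Lemma nrm_small_eq (A B : M) : (forall e : R, 0 < e -> nrm (A - B) <= e) -> A = B.
Proof.
move=> h; apply/eqP; rewrite -subr_eq0; apply/eqP/nrm_eq0/eqP.
rewrite eq_le nrm_ge0 andbT; apply/ler_addgt0Pr => e e0; rewrite add0r; exact: h.
Qed.

Lemma nrm_dag A : nrm (dag A) = nrm A.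
Proof. by rewrite /nrm !ip_trace dagK mxtrace_mulC. Qed.

Lemma cl_mix_herm A B : cl mix_rel A B -> dag A = A -> dag B = B.
Proof.
move=> h hA; apply: nrm_small_eq => e e0; have e20 : 0 < e / 2 by lra.
have [B' [F hF ->] hB] := h _ e20.
apply: le_trans (nrm_dist _ (F A) _) _.
by rewrite -{1}hA -mix_dag // -dagB nrm_dag nrmBC; lra.
Qed.

(** The real trace is the functional [kyfan] with k = N, for which the bound at A and the bound at
    -A give the two inequalities. *)
Lemma cl_mix_trace A B : cl mix_rel A B -> complex.Re (\tr B) = complex.Re (\tr A).
Proof.
move=> h; have tk X : complex.Re (\tr X) = kyfan N 1%:M X.
  rewrite /kyfan /mxtrace Re_sum; apply: eq_big => [i|i _]; first by rewrite ltn_ord.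
  by rewrite conjU1.
have le X Y : cl mix_rel X Y -> complex.Re (\tr Y) <= complex.Re (\tr X).
  move=> hXY; rewrite tk; apply: (cl_mix_kyfan hXY) unitary1 => W hW.
  by rewrite -[W]mul1mx -kyfan_conj -tk (mix_trace (mix_conj hW)).
apply/eqP; rewrite eq_le le //=.
have : complex.Re (\tr (- B)) <= complex.Re (\tr (- A)).
  apply: le => e /h[B' [F hF ->] hB]; exists (F (- A)); first by exists F.
  have F0 : F 0 = 0 by rewrite -[in LHS](subrr A) mixD // subrr.
  by rewrite -[- A]sub0r mixD // F0 sub0r opprK addrC nrmBC.
by rewrite !raddfN /=; case: (\tr A) (\tr B) => a b [c d] /=; rewrite lerN2.
Qed.

End Unitary.

(** * Spectral theorem and majorisation of diagonals *)

Section Spectral.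
Context {R : realType} {N : nat}.
Local Notation M := 'M[R[i]]_N.
Implicit Types (A B U V : M).

Definition cdiag (d : 'I_N -> R[i]) : M := \matrix_(i, j) (if i == j then d i else 0).
Definition rdiag (l : 'I_N -> R) : M := cdiag (fun i => (l i)%:C).

Lemma mul_cdiag d A i j : (cdiag d *m A) i j = d i * A i j.
Proof.
rewrite mxE (bigD1 i) //= big1 ?addr0 ?mxE ?eqxx // => k ki.
by rewrite mxE eq_sym (negbTE ki) mul0r.
Qed.
Lemma mul_mx_cdiag d A i j : (A *m cdiag d) i j = A i j * d j.
Proof.
rewrite mxE (bigD1 j) //= big1 ?addr0 ?mxE ?eqxx // => k ki.
by rewrite mxE (negbTE ki) mulr0.
Qed.
Lemma dag_cdiag d : dag (cdiag d) = cdiag (fun i => conjc (d i)).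
Proof.
apply/matrixP=> i j; rewrite dagE !mxE eq_sym.
by case: eqP => [->//|_]; rewrite conjc0.
Qed.

Lemma spectral_normal A : A *m dag A = dag A *m A ->
  exists V d, is_unitary V /\ A = conjU V (cdiag d).
Proof.
move=> hA; have /orthomx_spectralP h : A \is normalmx by apply/normalmxP.
have hU := spectral_unitarymx A.
have hD : dag (spectralmx A) = invmx (spectralmx A) by rewrite invmx_unitary.
exists (dag (spectralmx A)), (fun i => spectral_diag A 0 i); split.
  rewrite /is_unitary dagK hD mulVmx //; exact: spectral_unit.
rewrite /conjU dagK hD {1}h; congr (_ *m _ *m _).
by apply/matrixP=> i j; rewrite !mxE; case: eqP => [->|]; rewrite ?mulr1n ?mulr0n.
Qed.

Lemma cdiag_eq_conj (V : M) d d' : is_unitary V -> conjU V (cdiag d) = conjU V (cdiag d') -> d =1 d'.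
Proof.
move=> hV /(congr1 (conjU (dag V))); rewrite !conjUK // => /matrixP h i.
by have := h i i; rewrite !mxE eqxx.
Qed.

Lemma spectral_herm A : dag A = A -> exists V l, is_unitary V /\ A = conjU V (rdiag l).
Proof.
move=> hA; have [|V [d [hV eA]]] := @spectral_normal A; first by rewrite hA.
exists V, (fun i => complex.Re (d i)); split => //; rewrite eA; congr conjU.
move: hA; rewrite eA dag_conjU dag_cdiag => /(cdiag_eq_conj hV) h.
apply/matrixP=> i j; rewrite !mxE; case: eqP => // _; have := h i.
by case: (d i) => a b /= [] hb; congr Complex; lra.
Qed.

Lemma spectral_skew A : dag A = - A ->
  exists V th, is_unitary V /\ A = conjU V (cdiag (fun i => Complex 0 (th i))).
Proof.
move=> hA; have [|V [d [hV eA]]] := @spectral_normal A; first by rewrite hA mulmxN mulNmx.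
exists V, (fun i => complex.Im (d i)); split => //; rewrite eA; congr conjU.
move: hA; rewrite eA dag_conjU dag_cdiag -conjUN.
have -> : - cdiag d = cdiag (fun i => - d i).
  by apply/matrixP=> i j; rewrite !mxE; case: ifP; rewrite ?oppr0.
move=> /(cdiag_eq_conj hV) h.
apply/matrixP=> i j; rewrite !mxE; case: eqP => // _; have := h i.
by case: (d i) => a b /= [] ha; congr Complex; lra.
Qed.

Lemma spectral_unitary U : is_unitary U ->
  exists V d, [/\ is_unitary V, U = conjU V (cdiag d) & forall i, d i * conjc (d i) = 1].
Proof.
move=> hU; have [|V [d [hV eA]]] := @spectral_normal U; first by rewrite hU unitaryV.
exists V, d; split => // i.
move: hU; rewrite /is_unitary {1 2}eA dag_conjU -conjU_mul // => /(congr1 (conjU (dag V))).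
rewrite conjUK // conjU_id; last exact: unitary_dag.
move=> /matrixP/(_ i i); rewrite mul_cdiag dag_cdiag !mxE eqxx; exact.
Qed.

Lemma dag_perm (s : {perm 'I_N}) : dag (perm_mx s : M) = perm_mx s^-1.
Proof.
rewrite /dag tr_perm_mx; apply/matrixP=> i j; rewrite !mxE.
by case: (_ == _); rewrite ?conjc1 ?conjc0.
Qed.
Lemma unitary_perm (s : {perm 'I_N}) : is_unitary (perm_mx s : M).
Proof. by rewrite /is_unitary dag_perm -perm_mxM mulgV perm_mx1. Qed.
Lemma conjU_perm (s : {perm 'I_N}) A : conjU (perm_mx s) A = \matrix_(i, j) A (s i) (s j).
Proof.
by rewrite /conjU dag_perm -row_permE -col_permE; apply/matrixP=> i j; rewrite !mxE.
Qed.
Lemma conjU_perm_rdiag (s : {perm 'I_N}) l : conjU (perm_mx s) (rdiag l) = rdiag (fun i => l (s i)).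
Proof.
rewrite conjU_perm; apply/matrixP=> i j; rewrite !mxE (inj_eq perm_inj).
by case: eqP => // ->.
Qed.

Definition nonincr (l : 'I_N -> R) := forall i j : 'I_N, (i <= j)%N -> l j <= l i.

Lemma spectral_sorted A : dag A = A ->
  exists V l, [/\ is_unitary V, nonincr l & A = conjU V (rdiag l)].
Proof.
move=> /spectral_herm[V [l [hV eA]]].
pose rl (i j : 'I_N) := l j <= l i.
pose s := sort rl (enum 'I_N).
have szs : size s = N by rewrite size_sort size_enum_ord.
have us : uniq s by rewrite sort_uniq enum_uniq.
pose f (i : 'I_N) := nth i s i.
have finj : injective f.
  move=> i j; rewrite /f (set_nth_default i j) ?szs // => /eqP.
  by rewrite nth_uniq ?szs // => /eqP/val_inj.
exists (V *m dag (perm_mx (perm finj))), (fun i => l (f i)); split.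
- by apply: unitaryM => //; apply/unitary_dag/unitary_perm.
- have srt : sorted rl s.
    by apply: sort_sorted => i j; rewrite /rl; exact: le_total.
  have tr : transitive rl by move=> a b c h1 h2; exact: le_trans h2 h1.
  have rf : reflexive rl by move=> a; rewrite /rl lexx.
  move=> i j ij; rewrite /f (set_nth_default i j) ?szs //.
  by apply: (sorted_leq_nth tr rf i srt) ij; rewrite inE szs.
rewrite conjUM eA; congr conjU.
have -> : rdiag (fun i => l (f i)) = conjU (perm_mx (perm finj)) (rdiag l).
  by rewrite conjU_perm_rdiag; congr rdiag; apply: funext => i; rewrite permE.
by rewrite conjUK //; exact: unitary_perm.
Qed.

Lemma normc2E (x : R[i]) : x * conjc x = (complex.Re x ^+ 2 + complex.Im x ^+ 2)%:C.
Proof. by case: x => a b /=; congr Complex; ring. Qed.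

Definition psum (k : nat) (f : 'I_N -> R) : R := \sum_(i < N | (i < k)%N) f i.

Lemma sum_const_lt k (t : R) : (k <= N)%N -> \sum_(i < N | (i < k)%N) t = t * k%:R.
Proof.
by move=> kN; rewrite -(big_ord_widen N (fun=> t) kN) sumr_const card_ord mulr_natr.
Qed.

Lemma kyfan_rdiag k l : kyfan k 1%:M (rdiag l) = psum k l.
Proof. by rewrite /kyfan conjU1; apply: eq_bigr => i _; rewrite mxE eqxx. Qed.

(** The squared moduli of Q are doubly stochastic, so the functional is the sum of l_j c_j with
    weights c_j in [0, 1] of total k. With t the k-th largest entry, l_j c_j is at most t c_j, plus
    l_j - t for the first k indices; summing gives the partial sum. *)
Lemma schur_bound k l (Q : M) : (k <= N)%N -> nonincr l -> is_unitary Q ->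
  kyfan k Q (rdiag l) <= psum k l.
Proof.
move=> kN hl hQ.
have [k0|k0] := posnP k; first by rewrite k0 /kyfan /psum !big1.
pose q i j : R := complex.Re (Q i j) ^+ 2 + complex.Im (Q i j) ^+ 2.
have q0 i j : 0 <= q i j by rewrite addr_ge0 // sqr_ge0.
have rowq i : \sum_j q i j = 1.
  move: hQ => /matrixP/(_ i i); rewrite !mxE eqxx => h.
  apply: (@complexI R); rewrite -[RHS]h rmorph_sum; apply: eq_bigr => j _.
  by rewrite dagE normc2E.
have colq j : \sum_i q i j = 1.
  move: (unitaryV hQ) => /matrixP/(_ j j); rewrite !mxE eqxx => h.
  apply: (@complexI R); rewrite -[RHS]h rmorph_sum; apply: eq_bigr => i _.
  by rewrite dagE mulrC normc2E.
pose c j := \sum_(i < N | (i < k)%N) q i j.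
have -> : kyfan k Q (rdiag l) = \sum_j l j * c j.
  rewrite /kyfan; under [RHS]eq_bigr => j _ do rewrite mulr_sumr.
  rewrite exchange_big /=; apply: eq_bigr => i _.
  rewrite mxE Re_sum; apply: eq_bigr => j _.
  by rewrite mul_mx_cdiag dagE mulrAC normc2E -rmorphM mulrC.
have c0 j : 0 <= c j by apply: sumr_ge0.
have c1 j : c j <= 1.
  rewrite -(colq j) /c [X in X <= _]big_mkcond /=; apply: ler_sum => i _; by case: ifP.
have sc : \sum_j c j = k%:R.
  rewrite /c exchange_big /=; under eq_bigr => i _ do rewrite rowq.
  by rewrite sum_const_lt // mul1r.
have kp : (k.-1 < N)%N by rewrite prednK.
pose t := l (Ordinal kp).
have bnd j : l j * c j <= t * c j + (if (j < k)%N then l j - t else 0).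
  case: ifP => jk.
    have : t <= l j by apply: hl => /=; rewrite -ltnS prednK.
    by have := c1 j; nra.
  have : l j <= t by apply: hl => /=; rewrite leq_eqVlt; apply/orP; right; rewrite prednK // leqNgt jk.
  by have := c0 j; nra.
apply: le_trans (ler_sum _ (fun j _ => bnd j)) _.
rewrite big_split /= -mulr_sumr sc -big_mkcond sumrB /= -/(psum k l).
by rewrite sum_const_lt // addrC subrK.
Qed.

End Spectral.

(** * Hardy-Littlewood-Polya order generated by transfers *)

Section HLP.
Context {R : realType} {N : nat}.
Implicit Types x y : 'I_N -> R.

Definition transfer x (a b : 'I_N) (d : R) : 'I_N -> R :=
  fun i => if i == a then x i - d else if i == b then x i + d else x i.

Lemma psum_transfer k x a b d : a != b -> psum k (transfer x a b d) =
  psum k x - (if (a < k)%N then d else 0) + (if (b < k)%N then d else 0).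
Proof.
move=> ab; rewrite /psum.
have ind (c : 'I_N) : (if (c < k)%N then d else 0) = \sum_(i < N | (i < k)%N) (if i == c then d else 0).
  case: ifP => ck; last by rewrite big1 // => i ik; case: eqP => // eic; rewrite -eic ik in ck.
  by rewrite (bigD1 c) //= eqxx big1 ?addr0 // => i /andP[_ /negbTE->].
rewrite !ind -sumrB -big_split /=; apply: eq_bigr => i _; rewrite /transfer.
have [->|ia] := eqVneq i a; first by rewrite (negbTE ab) addr0.
by case: eqP; rewrite subr0 ?addr0.
Qed.

(** Induction on the number of entries where x and y differ: each transfer settles at least one of
    them. Only y is sorted, so x need not be rearranged after a transfer. *)
Lemma hlp (rel : ('I_N -> R) -> ('I_N -> R) -> Prop) y :
  (forall x, rel x x) -> (forall x x' x'', rel x x' -> rel x' x'' -> rel x x'') ->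
  (forall x (a b : 'I_N) (d : R), a != b -> 0 <= d -> d * 2 <= x a - x b -> rel x (transfer x a b d)) ->
  nonincr y -> forall x, (forall k, (k <= N)%N -> psum k y <= psum k x) -> psum N x = psum N y ->
  rel x y.
Proof.
move=> rrefl rtrans rT sy x.
have [n] := ubnP #|[set i | x i != y i]|; elim: n x => // n IH x; rewrite ltnS => cn dom tot.
have [/existsP[b0 hb0]|/existsPn nob] := boolP [exists b, x b < y b]; last first.
  suff -> : y = x by [].
  apply: funext => i; apply/eqP; rewrite eq_sym -subr_eq0.
  have : \sum_(i < N | (i < N)%N) (x i - y i) == 0 by rewrite sumrB -/(psum N x) tot subrr.
  rewrite psumr_eq0 => [/allP/(_ i (mem_index_enum _))|j _]; first by rewrite ltn_ord.
  by rewrite subr_ge0 leNgt.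
(* With b the first deficient index, every earlier index has x >= y, and dominance at b + 1 forces a
   surplus at some a < b. *)
case: (@arg_minnP _ b0 (fun b => x b < y b) (fun b => val b) hb0) => b xb bmin.
have dpos (i : 'I_N) : (i < b)%N -> y i <= x i.
  by move=> ib; rewrite leNgt; apply/negP => /bmin; rewrite leqNgt ib.
have [a ab xa] : exists2 a : 'I_N, (a < b)%N & y a < x a.
  apply: contrapT => hn.
  have hle (i : 'I_N) : (i < b)%N -> x i <= y i.
    by move=> ib; rewrite leNgt; apply/negP => h; apply: hn; exists i.
  have := dom b.+1 (ltn_ord b); rewrite /psum leNgt => /negP; apply.
  rewrite [ltLHS](bigD1 b) //= [ltRHS](bigD1 b) //= ltr_leD //.
  apply: ler_sum => i /andP[ib inb]; apply: hle.
  by rewrite ltn_neqAle inb -ltnS.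
have anb : a != b by apply: contraTneq ab => ->; rewrite ltnn.
(* The largest amount that overshoots neither target. Since y b <= y a, the gap x a - x b is at
   least the sum of the two differences, hence at least 2 d. *)
pose d := Num.min (x a - y a) (y b - x b).
have d0 : 0 < d by rewrite lt_min; apply/andP; split; lra.
have d1 : d <= x a - y a by rewrite ge_min lexx.
have d2 : d <= y b - x b by rewrite ge_min lexx orbT.
have yab : y b <= y a by apply: sy; exact: ltnW.
apply: (rtrans _ (transfer x a b d)).
  by apply: rT => //; [exact: ltW | lra].
apply: IH.
- apply: leq_trans cn; apply: proper_card; apply/properP; split.
    apply/fintype.subsetP => i; rewrite !inE /transfer.
    have [->|ia] := eqVneq i a; first by move=> _; rewrite gt_eqF.
    have [->|ib] := eqVneq i b; last by [].
    by move=> _; rewrite lt_eqF.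
  have [h|h] := leP (x a - y a) (y b - x b).
    exists a; first by rewrite inE gt_eqF.
    rewrite inE /transfer eqxx negbK /d; apply/eqP.
    by rewrite (min_idPl h); lra.
  exists b; first by rewrite inE lt_eqF.
  rewrite inE /transfer (eq_sym b a) (negbTE anb) eqxx negbK /d; apply/eqP.
  by rewrite (min_idPr (ltW h)); lra.
- move=> k kN; rewrite psum_transfer //; have := dom k kN.
  (* Only for a < k <= b does the partial sum drop, by d; there the surplus at a alone covers the
     loss, as no earlier index is deficient. *)
  have [ak|ak] := ltnP a k; have [bk|bk] := ltnP b k; try lra.
  move=> _; suff : d <= psum k x - psum k y by lra.
  rewrite /psum -sumrB (bigD1 a) //=; apply: le_trans d1 _.
  rewrite lerDl; apply: sumr_ge0 => i /andP[ik _].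
  by rewrite subr_ge0 dpos // (leq_trans ik).
- by rewrite psum_transfer // !ltn_ord tot; lra.
Qed.

End HLP.

(** * One-parameter groups and the Lie algebra of controllable directions *)

Section Ode.
Context {N : nat}.
Local Notation M := 'M[R[i]]_N.
Implicit Types (A B : M) (L : M -> M).

Lemma fin_delta (I : finType) (P : I -> R -> Prop) :
  (forall i, exists2 d : R, 0 < d & forall h : R, `|h| < d -> P i h) ->
  exists2 d : R, 0 < d & forall i (h : R), `|h| < d -> P i h.
Proof.
move=> H; have [f hf] := @choice I R (fun i d => 0 < d /\ forall h : R, `|h| < d -> P i h)
  (fun i => let: ex_intro2 d d0 hd := H i in ex_intro _ d (conj d0 hd)).
exists (\big[Num.min/1]_i f i).
  by apply: (big_ind (fun x : R => 0 < x)) => // [x y x0 y0|i _]; [rewrite lt_min x0 | have [] := hf i].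
move=> i h hh; have [_] := hf i; apply; apply: lt_le_trans hh _.
by rewrite (bigD1 i) //= ge_min lexx.
Qed.

Lemma derivable_pt_limP (f : R -> R) (x l : R) : derivable_pt_lim f x l <->
  forall e : R, 0 < e -> exists2 d : R, 0 < d & forall h : R, `|h| < d -> `|f (x + h) - f x - h * l| <= e * `|h|.
Proof.
split=> H e e0.
  have [[d d0] hd] := H e (elimT RltP e0).
  exists d; first exact/RltP.
  move=> h hh; have [->|h0] := eqVneq h 0.
    by rewrite addr0 subrr mul0r subr0 normr0 mulr0.
  have := hd h (elimN eqP h0); rewrite /= RabsE => /(_ (elimT RltP hh)) /RltP.
  rewrite RabsE !RealsE => hl.
  have -> : f (x + h) - f x - h * l = ((f (x + h) - f x) / h - l) * h by field.
  by rewrite normrM ler_wpM2r // ltW.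
have {}e0 : 0 < e by apply/RltP.
have e20 : 0 < e / 2 by lra.
have [d d0 hd] := H _ e20; exists (RIneq.mkposreal d (elimT RltP d0)) => h h0 /=.
rewrite RabsE => /RltP hh; have {}hd := hd h hh.
have h00 : h != 0 by apply/eqP.
apply/RltP; rewrite RabsE !RealsE.
have -> : (f (x + h) - f x) / h - l = (f (x + h) - f x - h * l) / h by field.
rewrite normrM normfV ltr_pdivrMr ?normr_gt0 //; apply: le_lt_trans hd _.
by rewrite ltr_pM2r ?normr_gt0 //; lra.
Qed.

Lemma has_derivP (phi : R -> M) t D : has_deriv phi t D <->
  forall p, derivable_pt_lim (fun s => co (phi s) p) t (co D p).
Proof.
split=> [H p|H].
  apply/derivable_pt_limP => e e0; have [d d0 hd] := H e e0; exists d => // h hh.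
  by apply: le_trans (hd h hh); rewrite -coZ -!coB co_le.
move=> e e0; pose c : R := #|{: 'I_N * 'I_N * bool}|%:R + 1.
have c0 : 0 < c by rewrite ltr_wpDl.
have [|d d0 hd] := @fin_delta _ (fun p h => `|co (phi (t + h)) p - co (phi t) p - h * co D p| <= e / c * `|h|).
  by move=> p; have /derivable_pt_limP := H p; apply; rewrite divr_gt0.
exists d => // h hh.
apply: le_trans (@nrm_le_bound _ _ _ (e / c * `|h|) _) _.
  by move=> p; rewrite !coB coZ hd.
rewrite mulrA ler_wpM2r // mulrCA; apply: ler_piMr; first exact: ltW.
by rewrite ler_pdivrMr // mul1r lerDl.
Qed.

Definition of_co (f : 'I_N * 'I_N * bool -> R) : M :=
  \matrix_(i, j) Complex (f (i, j, true)) (f (i, j, false)).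
Lemma co_of_co f p : co (of_co f) p = f p.
Proof. by case: p => -[i j] []; rewrite /co mxE. Qed.

Lemma Un_cvP (u : nat -> R) (l : R) :
  Rseries.Un_cv u l <-> forall e : R, 0 < e -> exists n0, forall n, (n0 <= n)%N -> `|u n - l| < e.
Proof.
split=> H e e0.
  have [n0 hn] := H e (elimT RltP e0); exists n0 => n nn.
  by have /RltP := hn n (elimT ssrnat.leP nn); rewrite RdistE.
have [n0 hn] := H e (introT RltP e0); exists n0 => n nn.
by apply/RltP; rewrite RdistE; apply: hn; apply/ssrnat.leP.
Qed.

Lemma fin_rank (I : finType) (P : I -> nat -> Prop) :
  (forall i, exists n0, forall n, (n0 <= n)%N -> P i n) ->
  exists n0, forall i n, (n0 <= n)%N -> P i n.
Proof.
move=> /choice[f hf]; exists (\max_i f i) => i n hn; apply: hf.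
exact: leq_trans (leq_bigmax _) hn.
Qed.

(** The series of t^k / k! times the k-th iterate of L on A, summed coordinatewise. L maps its
    partial sums to those of the differentiated series and is bounded, so uniqueness of limits
    identifies the derivative with L(phi t). *)
Lemma linear_ode L A : blin L -> exists phi : R -> M,
  phi 0 = A /\ forall t, has_deriv phi t (L (phi t)).
Proof.
move=> bL; have [K K0 hK] := blin_bound bL.
pose it n := iter n L A.
have itb n : nrm (it n) <= nrm A * K ^+ n.
  elim: n => [|n IH]; first by rewrite expr0 mulr1.
  apply: le_trans (hK _) _; rewrite exprS mulrCA; exact: ler_wpM2l.
have ser p : exists fg : (R -> R) * (R -> R), fg.1 0 = co A p /\ forall t,
    derivable_pt_lim fg.1 t (fg.2 t) /\
    Rseries.Un_cv (Rfunctions.sum_f_R0 (fun n => co (it n) p / n`!%:R * t ^+ n)) (fg.1 t) /\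
    Rseries.Un_cv (Rfunctions.sum_f_R0 (fun n => co (it n.+1) p / n`!%:R * t ^+ n)) (fg.2 t).
  have [|f [g [f0 H]]] := RealFacts.exp_type_series (fun n => co (it n) p) (nrm A) K.
    by move=> n; apply/RleP; rewrite RabsE !RealsE; apply: le_trans (co_le _ _) (itb n).
  exists (f, g); split=> //= t; have [h1 [h2 h3]] := H t; split=> //.
  have e (u : nat -> R) : (fun n => Rmult (Rdiv (u n) (Raxioms.INR (Factorial.fact n))) (Rpow_def.pow t n)) = (fun n => u n / n`!%:R * t ^+ n).
    by apply: funext => n; rewrite !RealsE.
  by rewrite -(e (fun n => co (it n) p)) -(e (fun n => co (it n.+1) p)).
have [fg hfg] := choice ser.
pose phi t := of_co (fun p => (fg p).1 t).
exists phi; split.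
  by apply: coP => p; rewrite co_of_co (proj1 (hfg p)).
move=> t; apply/has_derivP => p.
have -> : (fun s => co (phi s) p) = (fg p).1 by apply: funext => s; rewrite co_of_co.
have [h1 [h2 h3]] := proj2 (hfg p) t.
suff -> : co (L (phi t)) p = (fg p).2 t by [].
pose S n : M := \sum_(0 <= k < n.+1) (k`!%:R^-1 * t ^+ k)%:C *: it k.
pose S' n : M := \sum_(0 <= k < n.+1) (k`!%:R^-1 * t ^+ k)%:C *: it k.+1.
have LS n : L (S n) = S' n.
  rewrite /S /S'; apply: (big_ind2 (fun x y => L x = y)) => [|x x' y y' <- <-|k _].
  - by have := blinB 0 0 bL; rewrite !subrr.
  - exact: (blinD bL).
  - exact: (blinZ bL).
have coS (F : nat -> M) n q : co (\sum_(0 <= k < n.+1) (k`!%:R^-1 * t ^+ k)%:C *: F k) q =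
    Rfunctions.sum_f_R0 (fun k => co (F k) q / k`!%:R * t ^+ k) n.
  rewrite sum_f_R0E; apply: (big_ind2 (fun x y => co x q = y)) => [|x x' y y' <- <-|k _].
  - exact: co0.
  - exact: coD.
  - by rewrite coZ; ring.
have Scv e : 0 < e -> exists n0, forall n, (n0 <= n)%N -> nrm (S n - phi t) <= e.
  move=> e0; pose c : R := #|{: 'I_N * 'I_N * bool}|%:R + 1.
  have c0 : 0 < c by rewrite ltr_wpDl.
  have [|n0 hn] := @fin_rank _ (fun q n => `|co (S n) q - co (phi t) q| < e / c).
    move=> q; have [_ [h _]] := proj2 (hfg q) t.
    have [n0 hn] := (proj1 (Un_cvP _ _) h) _ (divr_gt0 e0 c0).
    by exists n0 => n /hn; rewrite co_of_co /S coS.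
  exists n0 => n nn; apply: le_trans (@nrm_le_bound _ _ _ (e / c) _) _.
    by move=> q; rewrite coB ltW // hn.
  rewrite mulrCA; apply: ler_piMr; first exact: ltW.
  by rewrite ler_pdivrMr // mul1r lerDl.
apply: SeqProp.UL_sequence h3; apply/Un_cvP => e e0.
have q0 : 0 < e / (2 * (K + 1)) by rewrite divr_gt0 //; lra.
have [n0 hn] := Scv _ q0; exists n0 => n nn.
rewrite -coS -/(S' n) -LS -coB -(blinB _ _ bL).
apply: le_lt_trans (co_le _ _) _; apply: le_lt_trans (hK _) _.
have := hn n nn; rewrite ler_pdivlMr; last lra.
have := nrm_ge0 (S n - phi t); nra.
Qed.

End Ode.

Definition cis (x : R) : R[i] := Complex (cos x) (sin x).
Lemma cisD x y : cis (x + y) = cis x * cis y.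
Proof. by rewrite /cis cosD sinD; congr Complex; rewrite /=; ring. Qed.
Lemma cis0 : cis 0 = 1.
Proof. by rewrite /cis Rtrigo_def.cos_0 Rtrigo_def.sin_0. Qed.
Lemma conj_cis x : conjc (cis x) = cis (- x).
Proof.
by congr Complex; [exact: (esym (Rtrigo1.cos_neg x)) | exact: (esym (Rtrigo1.sin_neg x))].
Qed.

(** * Unitary one-parameter groups and their generators *)

Section Paths.
Context {N : nat}.
Local Notation M := 'M[R[i]]_N.
Implicit Types (A B U V X Y : M) (L : M -> M).

(** The exponential of t times [logU V th], written in an eigenbasis; by [spectral_skew] every
    skew-hermitian matrix is some [logU V th], so no matrix exponential series is needed here. *)
Definition expU V (th : 'I_N -> R) (t : R) : M := conjU V (cdiag (fun i => cis (t * th i))).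
Definition logU V (th : 'I_N -> R) : M := conjU V (cdiag (fun i => Complex 0 (th i))).

Lemma cdiagM d e : cdiag d *m cdiag e = cdiag (fun i => d i * e i) :> M.
Proof.
apply/matrixP=> i j; rewrite mul_cdiag !mxE; case: eqP => [->//|_]; exact: mulr0.
Qed.
Lemma cdiag1 : cdiag (fun=> 1) = 1%:M :> M.
Proof. by apply/matrixP=> i j; rewrite !mxE; case: eqP. Qed.

Lemma expUD V th s t : is_unitary V -> expU V th (s + t) = expU V th s *m expU V th t.
Proof.
move=> hV; rewrite /expU -(conjU_mul _ _ hV) cdiagM; congr (conjU _ (cdiag _)).
by apply: funext => i; rewrite mulrDl cisD.
Qed.
Lemma expU0 V th : is_unitary V -> expU V th 0 = 1%:M.
Proof.
move=> hV; rewrite /expU -(conjU_id hV) -cdiag1; congr (conjU _ (cdiag _)).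
by apply: funext => i; rewrite mul0r cis0.
Qed.
Lemma dag_expU V th t : dag (expU V th t) = expU V th (- t).
Proof.
rewrite /expU dag_conjU dag_cdiag; congr (conjU _ (cdiag _)).
by apply: funext => i; rewrite conj_cis mulNr.
Qed.
Lemma unitary_expU V th t : is_unitary V -> is_unitary (expU V th t).
Proof. by move=> hV; rewrite /is_unitary dag_expU -expUD // subrr expU0. Qed.

Lemma has_deriv_conjU U (phi : R -> M) t D : is_unitary U -> has_deriv phi t D ->
  has_deriv (fun s => conjU U (phi s)) t (conjU U D).
Proof.
move=> hU h e /h[d d0 hd]; exists d; first exact: d0.
move=> x /hd.
by rewrite -conjUZ -!conjUB nrm_conjU.
Qed.

Lemma ad_conjU U X A : is_unitary U -> ad (conjU U X) (conjU U A) = conjU U (ad X A).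
Proof. by move=> hU; rewrite /ad -!conjU_mul // -conjUB. Qed.

(** In the eigenbasis the conjugation decouples: entry (i, j) rotates with frequency th_i - th_j. *)
Lemma has_deriv_expU V th A t : is_unitary V ->
  has_deriv (fun s => conjU (expU V th s) A) t (ad (logU V th) (conjU (expU V th t) A)).
Proof.
move=> hV; pose B := conjU (dag V) A.
pose psi s := conjU (cdiag (fun i => cis (s * th i))) B.
have e s : conjU (expU V th s) A = conjU V (psi s).
  by rewrite /psi /B -!conjUM.
rewrite (_ : (fun s => _) = (fun s => conjU V (psi s))); last exact: funext.
rewrite e /logU ad_conjU //; apply: has_deriv_conjU => //.
have psiE s i j : psi s i j = cis (s * (th i - th j)) * B i j.
  rewrite /psi /conjU dag_cdiag mul_mx_cdiag mul_cdiag conj_cis mulrBr cisD; ring.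
apply/has_derivP => -[[i j] b].
have [h1 h2] := RealFacts.derivable_rotation (complex.Re (B i j)) (complex.Im (B i j)) (th i - th j) t.
have dE : ad (cdiag (fun i => Complex 0 (th i))) (psi t) i j = Complex 0 (th i - th j) * psi t i j.
  rewrite /ad mxE [X in _ + X]mxE mul_cdiag mul_mx_cdiag.
  rewrite [_ * Complex _ _]mulrC -mulrBl; congr (_ * _).
  by apply/eqP; rewrite eq_complex /= subr0 !eqxx.
case: b; rewrite /co /= dE psiE.
- rewrite (_ : (fun s => _) = (fun s => cos (s * (th i - th j)) * complex.Re (B i j) - sin (s * (th i - th j)) * complex.Im (B i j))); last first.
    by apply: funext => s; rewrite psiE; case: (B i j).
  rewrite (_ : complex.Re (Complex 0 _ * _) = - ((th i - th j) * (cos (t * (th i - th j)) * complex.Im (B i j) + sin (t * (th i - th j)) * complex.Re (B i j)))) //.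
  by case: (B i j) => p q /=; ring.
- rewrite (_ : (fun s => _) = (fun s => cos (s * (th i - th j)) * complex.Im (B i j) + sin (s * (th i - th j)) * complex.Re (B i j))); last first.
    by apply: funext => s; rewrite psiE; case: (B i j).
  rewrite (_ : complex.Im (Complex 0 _ * _) = (th i - th j) * (cos (t * (th i - th j)) * complex.Re (B i j) - sin (t * (th i - th j)) * complex.Im (B i j))) //.
  by case: (B i j) => p q /=; ring.
Qed.

Lemma logUN V th : logU V (fun i => - th i) = - logU V th.
Proof.
rewrite /logU -conjUN; congr conjU; apply/matrixP=> i j; rewrite !mxE.
by case: eqP => _; rewrite ?oppr0 //; apply/eqP; rewrite eq_complex /= oppr0 !eqxx.
Qed.
Lemma expUN V th t : expU V (fun i => - th i) t = expU V th (- t).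
Proof. by rewrite /expU; congr (conjU _ (cdiag _)); apply: funext => i; rewrite mulrN mulNr. Qed.

Lemma nrm_ad : exists2 K : R, 0 <= K & forall X A, nrm (ad X A) <= K * nrm X * nrm A.
Proof.
have [K K0 hK] := @nrmM R N; exists (K *+ 2); first by rewrite mulrn_wge0.
move=> X A; apply: le_trans (nrmB _ _) _.
have := hK X A; have := hK A X; rewrite (mulrC (nrm A)) !mulrA mulr2n; lra.
Qed.

Lemma adDl X Y A : ad (X + Y) A = ad X A + ad Y A.
Proof. by rewrite /ad mulmxDl mulmxDr opprD addrACA. Qed.
Lemma adZl c X A : ad (c *: X) A = c *: ad X A.
Proof. by rewrite /ad -scalemxAl -scalemxAr scalerBr. Qed.
Lemma adNl X A : ad (- X) A = - ad X A.
Proof. by rewrite /ad mulNmx mulmxN opprB addrC opprK. Qed.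

Section Fixr.
Variable r : M -> M -> Prop.
Hypothesis cr : contractive r.

Lemma tangent_expU V th : is_unitary V -> tangent r (ad (logU V th)) ->
  forall (t : R) A, 0 <= t -> cl r A (conjU (expU V th t) A).
Proof.
move=> hV tL t A t0.
have := tangent_flow cr t0 tL (fun s => has_deriv_expU th A s hV).
by rewrite expU0 // conjU1.
Qed.

Lemma expU_tangent V th : is_unitary V ->
  (forall (t : R) A, 0 <= t -> cl r A (conjU (expU V th t) A)) -> tangent r (ad (logU V th)).
Proof.
move=> hV H; apply: (flow_tangent cr) => [|A]; first exact: blin_ad.
exists (fun s => conjU (expU V th s) A); split=> [|t|t t0].
- by rewrite expU0 // conjU1.
- exact: has_deriv_expU.
- exact: H.
Qed.

(** Conjugation by the group of X is isometric, so recurrence supplies its negative times, and these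
    are the positive times of the group of -X. *)
Lemma tangent_skew_recurrent X : dag X = - X -> tangent r (ad X) -> tangent r (ad (- X)).
Proof.
move=> /spectral_skew[V [th [hV ->]]]; rewrite -/(logU V th) => tX.
rewrite -logUN; apply: expU_tangent => // t A _; rewrite expUN.
apply: (@recurrence _ _ _ (fun t A => conjU (expU V th t) A)) => {t A}.
- by move=> A; rewrite expU0 // conjU1.
- by move=> s t A; rewrite (expUD th s t hV) conjUM.
- by move=> t A B; rewrite -conjUB nrm_conjU //; exact: unitary_expU.
- by move=> t; rewrite /conjU mulmx0 mul0mx.
- by move=> t A t0; exact: tangent_expU.
Qed.

Lemma tangent_conjU U L : is_unitary U -> (forall A, cl r A (conjU U A)) ->
  (forall A, cl r A (conjU (dag U) A)) -> tangent r L ->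
  tangent r (fun A => conjU U (L (conjU (dag U) A))).
Proof.
move=> hU c1 c2 tL e e0; have [d d0 hd] := tL e e0; exists d; first exact: d0.
move=> h hh A.
have [B cB hB] := hd h hh (conjU (dag U) A).
exists (conjU U B); first exact: cl_trans cr _ _ _ (c2 A) (cl_trans cr cB (c1 B)).
rewrite -{1}(conjUVK A hU) -conjUZ -conjUD -conjUB nrm_conjU //.
by rewrite -(nrm_conjU A (unitary_dag hU)).
Qed.

Definition inlie X := [/\ dag X = - X, tangent r (ad X) & tangent r (ad (- X))].

Lemma inlie_recurrent X : dag X = - X -> tangent r (ad X) -> inlie X.
Proof. by move=> h1 h2; split; [exact: h1 | exact: h2 | exact: tangent_skew_recurrent]. Qed.

Lemma inlieN X : inlie X -> inlie (- X).
Proof. by case=> h1 h2 h3; split; [rewrite dagN h1 | exact: h3 | rewrite opprK; exact: h2]. Qed.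

Lemma inlieD X Y : inlie X -> inlie Y -> inlie (X + Y).
Proof.
case=> h1 h2 _ [k1 k2 _]; apply: inlie_recurrent.
  by rewrite dagD h1 k1 opprD.
by apply: tangent_ext (tangentD cr (blin_ad X) (blin_ad Y) h2 k2) => A; rewrite adDl.
Qed.

Lemma inlieZ (c : R) X : inlie X -> inlie (c%:C *: X).
Proof.
have pos (c' : R) Y : 0 <= c' -> inlie Y -> inlie (c'%:C *: Y).
  move=> c0 [h1 h2 _]; apply: inlie_recurrent; first by rewrite dagZr h1 scalerN.
  by apply: tangent_ext (tangentZ cr c0 h2) => A; rewrite adZl.
have [c0|c0] := leP 0 c; first exact: pos.
move=> /inlieN/(pos (- c)); rewrite rmorphN scaleNr scalerN opprK; apply.
by rewrite oppr_ge0 ltW.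
Qed.

Lemma inlie0 : inlie 0.
Proof.
apply: inlie_recurrent; first by rewrite dag0 oppr0.
move=> e e0; exists 1 => // h /andP[h0 _] A; exists A; first exact: cl_refl.
by rewrite /ad mul0mx mulmx0 subrr scaler0 addr0 subrr nrm0 !mulr_ge0 ?nrm_ge0 // ltW.
Qed.

Lemma inlie_expU V th t A : is_unitary V -> inlie (logU V th) -> cl r A (conjU (expU V th t) A).
Proof.
move=> hV [_ h1 h2]; have [t0|t0] := leP 0 t; first exact: tangent_expU.
rewrite -[t]opprK -expUN; apply: tangent_expU; [exact: hV | rewrite logUN; exact: h2 |].
by rewrite oppr_ge0 ltW.
Qed.

(* [X, Y] is the derivative at 0 of the conjugates of Y along exp(sX), which all stay in the wedge. *)
Lemma inlie_comm X Y : inlie X -> inlie Y -> inlie (ad X Y).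
Proof.
move=> hX hY; apply: inlie_recurrent.
  case: hX hY => hX _ _ [hY _ _].
  by rewrite /ad dagB !dagM hX hY !mulmxN !mulNmx !opprK opprB.
have [V [th [hV eX]]] := spectral_skew (let: And3 h _ _ := hX in h).
rewrite -/(logU V th) in eX; rewrite eX in hX *.
apply: tangent_closed => e e0; have [K K0 hK] := nrm_ad.
have q0 : 0 < e / (K + 1) by rewrite divr_gt0 // ltr_wpDl.
have [d d0 hd] := has_deriv_expU th Y 0 hV q0.
pose s := d / 2; have s0 : 0 < s by rewrite /s; lra.
have := hd s; rewrite gtr0_norm // => /(_ _)/wrap[|]; first by rewrite /s; lra.
rewrite add0r expU0 // !conjU1; set Z := conjU _ Y => hZ.
have hU := unitary_expU th s hV.
have tZ : tangent r (ad Z).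
  have := @tangent_conjU (expU V th s) (ad Y) hU (fun A => inlie_expU s A hV hX) _ (let: And3 _ h _ := hY in h).
  move=> /(_ _)/wrap[A|]; first by rewrite dag_expU; exact: inlie_expU.
  by apply: tangent_ext => A; rewrite -ad_conjU // conjUVK.
(* [ad] of the difference quotient (Z - Y) / s, as a combination with nonnegative coefficients; the
   term -Y is why [inlie] keeps both signs. *)
exists (fun A => s^-1%:C *: ad Z A + s^-1%:C *: ad (- Y) A).
  have s10 : 0 <= s^-1 by rewrite invr_ge0 ltW.
  apply: (tangentD cr); [exact: blin_scale (blin_ad _) | exact: blin_scale (blin_ad _) | |].
    by apply: (tangentZ cr); [exact: s10 | exact: tZ].
  by apply: (tangentZ cr); [exact: s10 | case: hY].
move=> A; have -> : s^-1%:C *: ad Z A + s^-1%:C *: ad (- Y) A - ad (ad (logU V th) Y) A =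
    ad (s^-1%:C *: (Z - Y - s%:C *: ad (logU V th) Y)) A.
  move: (ad (logU V th) Y) => D.
  rewrite adZl (adDl (Z - Y) (- (s%:C *: D))) (adDl Z (- Y)) (adNl Y) (adNl (_ *: D)) adZl.
  move: (ad Z A) (ad Y A) (ad D A) => a b c.
  rewrite !scalerBr scalerN scalerA -rmorphM mulVf ?gt_eqF //.
  by rewrite rmorph1 scale1r.
apply: le_trans (hK _ _) _; rewrite nrmZ gtr0_norm ?invr_gt0 //.
apply: ler_wpM2r; first exact: nrm_ge0.
have h1 : s^-1 * nrm (Z - Y - s%:C *: ad (logU V th) Y) <= e / (K + 1).
  by rewrite mulrC ler_pdivrMr.
apply: le_trans (ler_wpM2l K0 h1) _.
rewrite mulrCA; apply: ler_piMr; first exact: ltW.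
by rewrite ler_pdivrMr ?ltr_wpDl // mul1r lerDl.
Qed.

Lemma conjU_scale (c : R[i]) U A : conjU (c *: U) A = (c * conjc c) *: conjU U A.
Proof. by rewrite /conjU dagZ -!scalemxAl -scalemxAr scalerA. Qed.

(** A global phase does not affect conjugation. Subtracting the mean eigenangle therefore replaces U
    by a phase multiple whose logarithm is traceless, hence in the given Lie algebra. *)
Lemma all_unitary U A : (0 < N)%N ->
  (forall X, dag X = - X -> \tr X = 0 -> inlie X) ->
  is_unitary U -> cl r A (conjU U A).
Proof.
move=> N0 H hU; have [V [d [hV eU hd]]] := spectral_unitary hU.
have ang i : exists th, cis th = d i.
  have := hd i; rewrite normc2E => /complexI; case: (d i) => x y /= hxy.
  have [|th [hc hs]] := RealFacts.circle_angle x y; first by rewrite !RealsE -!expr2.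
  by exists th; rewrite /cis hc hs.
have [th hth] := choice ang.
pose mu : R := (\sum_i th i) / N%:R.
pose th' i := th i - mu.
have eq : expU V th' 1 = cis (- mu) *: U.
  rewrite eU -conjUZ /expU; congr conjU; apply/matrixP=> i j; rewrite !mxE.
  case: eqP => _; last by rewrite mulr0.
  by rewrite mul1r /th' addrC cisD hth.
have -> : conjU U A = conjU (expU V th' 1) A.
  by rewrite eq conjU_scale conj_cis -cisD subrr cis0 scale1r.
apply: inlie_expU; first exact: hV.
apply: H.
  rewrite /logU dag_conjU dag_cdiag -conjUN; congr conjU; apply/matrixP=> i j; rewrite !mxE.
  by case: eqP => _; rewrite ?oppr0 //; apply/eqP; rewrite eq_complex /= oppr0 !eqxx.
rewrite (mix_trace (mix_conj hV)) /mxtrace.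
have -> : \sum_i cdiag (fun i => Complex 0 (th' i)) i i = Complex 0 (\sum_i th' i).
  apply: (big_ind2 (fun x y => x = Complex 0 y)) => // [x x' y y' -> ->|i _].
    by rewrite -[RHS]/(Complex _ _) -[LHS]/(Complex (0 + 0) _) addr0.
  by rewrite mxE eqxx.
have Nn : N%:R != 0 :> R by rewrite pnatr_eq0 -lt0n.
suff -> : \sum_i th' i = 0 by [].
by rewrite /th' sumrB sumr_const card_ord -[mu *+ N]mulr_natr /mu (divfK Nn) subrr.
Qed.

(** A = S + D, with S fixed and D negated by Ad X. The flow keeps S and multiplies D by exp(-2 c t),
    while the mixture with weight mu is S + (1 - 2 mu) D, so mu < 1/2 is a finite time. *)
Lemma flip_mixture (c : R) X A (mu : R) : 0 < c -> dag X = X -> X *m X = 1%:M ->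
  tangent r (fun A => c%:C *: flip X A) -> 0 <= mu <= 1 / 2 ->
  cl r A ((1 - mu)%:C *: A + mu%:C *: conjU X A).
Proof.
move=> c0 hX XX tX /andP[m0 m1].
have XK B : conjU X (conjU X B) = B by rewrite -conjUM XX conjU1.
pose S := (1 / 2)%:C *: (A + conjU X A); pose D := (1 / 2)%:C *: (A - conjU X A).
have half (B : M) : (1 / 2)%:C *: B + (1 / 2)%:C *: B = B.
  by rewrite -scalerDl -rmorphD (_ : 1 / 2 + 1 / 2 = 1 :> R) ?scale1r //; lra.
have main (x : R) : 0 < x <= 1 -> cl r A (S + x%:C *: D).
  move=> /andP[x0 x1].
  have [||t [t0 ht]] := RealFacts.exp_decay_onto (2 * c) x.
  - by apply/RltP; rewrite mulr_gt0.
  - by split; [apply/RltP | apply/RleP].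
  rewrite -ht; pose phi (s : R) := S + (exp (- (s * (2 * c))))%:C *: D.
  have -> : A = phi 0.
    rewrite /phi mul0r oppr0 expR0 scale1r /S /D !scalerDr scalerN addrACA half.
    by rewrite subrr addr0.
  have tR : 0 <= t by apply/RleP.
  apply: (tangent_flow cr tR tX) => s; apply/has_derivP => p.
  have := RealFacts.derivable_decay (co S p) (co D p) (2 * c) s.
  rewrite !RealsE => h.
  rewrite (_ : (fun s => co (phi s) p) = (fun s => co S p + exp (- (s * (2 * c))) * co D p)); last first.
    by apply: funext => u; rewrite /phi (coD S) (coZ _ D).
  suff -> : co (c%:C *: flip X (phi s)) p = - (2 * c * (exp (- (s * (2 * c))) * co D p)) by exact: h.
  have fS : conjU X S = S by rewrite /S conjUZ conjUD XK addrC.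
  have fD : conjU X D = - D by rewrite /D conjUZ conjUB XK -scalerN opprB.
  move: S D fS fD @phi h => S D fS fD phi h.
  rewrite /flip /phi conjUD conjUZ fS fD coZ coB !coD !coZ coN; ring.
have e (x : R) : (1 - x)%:C *: A + x%:C *: conjU X A = S + (1 - 2 * x)%:C *: D.
  rewrite /S /D; move: (conjU X A) => B.
  by apply: coP => p; rewrite !coD !coZ coD coB; field.
rewrite e; have [lt|ge] := ltP mu (1 / 2); first by apply: main; apply/andP; split; lra.
(* At mu = 1/2 the component D must vanish, which no finite time achieves; small factors x are used
   instead and the closure is taken. *)
have -> : 1 - 2 * mu = 0 by lra.
apply: cl_closed => q q0; have nD := nrm_ge0 D.
pose x := Num.min 1 (q / (2 * (nrm D + 1))).
have x0 : 0 < x by rewrite lt_min ltr01 /= divr_gt0 //; lra.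
have x1 : x <= 1 by rewrite ge_min lexx.
have x2 : x <= q / (2 * (nrm D + 1)) by rewrite ge_min lexx orbT.
exists (S + x%:C *: D); first by apply: main; rewrite x0.
rewrite rmorph0 scale0r addr0 addrAC subrr add0r nrmZ gtr0_norm //.
move: x2; rewrite ler_pdivlMr; last lra.
by nra.
Qed.

End Fixr.
End Paths.

(** * Transfers between two diagonal entries *)

Section Protect.
Context {R : realType} {N : nat}.
Local Notation M := 'M[R[i]]_N.
Variables (pi : {perm 'I_N}) (s : 'I_N -> bool) (c0 : 'I_N).
Hypothesis piK : forall i, pi (pi i) = i.
Hypothesis s_pi : forall i, s (pi i) = ~~ s i.
Local Notation c1 := (pi c0).
Local Notation X := (perm_mx pi : M).

Let pi_ne i : pi i != i.
Proof. by apply/eqP => h; have := s_pi i; rewrite h; case: (s i). Qed.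

Let sp i := (i == c0) || (i == c1).
Let sp_pi i : sp (pi i) = sp i.
Proof. by rewrite /sp -[X in pi i == X]piK !(inj_eq perm_inj) orbC. Qed.

Let w : R := (Num.sqrt 2)^-1.
Let ww : w * w = 1 / 2.
Proof.
rewrite /w -invrM ?unitfE ?sqrtr_eq0 -?ltNge ?ltr0n //.
by rewrite -expr2 sqr_sqrtr ?ler0n // div1r.
Qed.

Let al i : R := if sp i then 1 else if s i then - w else w.
Let be i : R := if sp i then 0 else w.

(* Off the pair (c0, c1) this is the Hadamard rotation of each block {i, pi i}, taking sigma_x to sigma_z. *)
Definition protect : M := cdiag (fun i => (al i)%:C) + cdiag (fun i => (be i)%:C) *m X.

Lemma mul_protect (A : M) i j : (protect *m A) i j = (al i)%:C * A i j + (be i)%:C * A (pi i) j.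
Proof.
rewrite mulmxDl -mulmxA -row_permE mxE !mul_cdiag; congr (_ + _ * _).
by rewrite mxE.
Qed.

Lemma protectE i j : protect i j = ((al i) *+ (i == j) + (be i) *+ (pi i == j))%:C.
Proof.
rewrite mxE mul_cdiag !mxE rmorphD; congr (_ + _); first by case: eqP; rewrite ?mulr1n ?mulr0n.
by case: eqP; rewrite ?mulr1n ?mulr0n ?mulr1 ?mulr0.
Qed.

Lemma dag_protect : dag protect = protect.
Proof.
apply/matrixP=> i j; rewrite dagE !protectE conjc_real; congr (_ %:C).
have e : (pi j == i) = (pi i == j) by apply/eqP/eqP => <-; rewrite piK.
rewrite e eq_sym; case: (i =P j) => [->|_] //.
congr (_ + _); case: eqP => // <-; by rewrite /be sp_pi.
Qed.

Lemma unitary_protect : is_unitary protect.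
Proof.
rewrite /is_unitary dag_protect; apply/matrixP=> i j.
rewrite mul_protect !protectE -!rmorphM -rmorphD piK mxE.
rewrite (_ : (i == j)%:R = ((i == j)%:R : R)%:C); last by case: eqP.
congr (_ %:C).
have := ww; rewrite /al /be sp_pi s_pi; case: (sp i); first by move=> _; rewrite mul0rn addr0 mul0r addr0 mul1r.
by case: (s i); case: (i == j); case: (pi i == j); rewrite /= ?mulr1n ?mulr0n; lra.
Qed.

Lemma conj_protect : conjU protect X =
  cdiag (fun i => (if sp i then 1 else if s i then -1 else 1 : R)%:C) *m perm_mx (tperm c0 c1).
Proof.
rewrite /conjU dag_protect -mulmxA; apply/matrixP=> i j.
have rp (k l : 'I_N) : (X *m protect) k l = protect (pi k) l by rewrite -row_permE mxE.
rewrite mul_protect !rp !protectE piK -!rmorphM -rmorphD mul_cdiag !mxE.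
rewrite (_ : (tperm c0 c1 i == j)%:R = ((tperm c0 c1 i == j)%:R : R)%:C); last by case: eqP.
rewrite -rmorphM; congr (_ %:C).
have tp : tperm c0 c1 i = if sp i then pi i else i.
  rewrite /sp; have [->|n0] := eqVneq i c0; first by rewrite tpermL.
  have [->|n1] := eqVneq i c1; first by rewrite tpermR piK.
  by rewrite tpermD // eq_sym.
have := ww; rewrite tp /al /be sp_pi s_pi; case: (sp i) => /=.
  by move=> _; rewrite mul0rn addr0 mul0r addr0.
by case: (s i); case: (i == j); case: (pi i == j); rewrite /= ?mulr1n ?mulr0n; lra.
Qed.

(** The signs in [conj_protect] act on both sides of a diagonal matrix and square to 1; only the
    transposition remains. *)
Lemma conj_protect_rdiag x :
  conjU (conjU protect X) (rdiag x) = rdiag (fun i => x (tperm c0 c1 i)).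
Proof.
rewrite conj_protect conjUM conjU_perm_rdiag.
apply/matrixP=> i j; rewrite /conjU dag_cdiag mul_mx_cdiag mul_cdiag !mxE.
case: eqP => [<-|_]; last by rewrite mulr0 mul0r.
rewrite conjc_real mulrAC -!rmorphM; congr (_ %:C).
by case: (sp i); [ring | case: (s i); ring].
Qed.

Variable r : M -> M -> Prop.
Hypothesis cr : contractive r.
Hypothesis all_conj : forall U A, is_unitary U -> cl r A (conjU U A).
Hypothesis mixture : forall A (mu : R), 0 <= mu <= 1 / 2 ->
  cl r A ((1 - mu)%:C *: A + mu%:C *: conjU X A).

Lemma cl_conj_mixture W A (mu : R) : is_unitary W -> 0 <= mu <= 1 / 2 ->
  cl r A ((1 - mu)%:C *: A + mu%:C *: conjU (conjU W X) A).
Proof.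
move=> hW hmu.
have h1 := all_conj A (unitary_dag hW).
have h2 := mixture (conjU (dag W) A) hmu.
have h3 := all_conj ((1 - mu)%:C *: conjU (dag W) A + mu%:C *: conjU X (conjU (dag W) A)) hW.
have := cl_trans cr h1 (cl_trans cr h2 h3).
by rewrite conjUD !conjUZ (conjUVK A hW) -!conjUM.
Qed.

Lemma rdiag_comb (mu : R) x y :
  (1 - mu)%:C *: rdiag x + mu%:C *: rdiag y = rdiag (fun i => (1 - mu) * x i + mu * y i) :> M.
Proof.
apply/matrixP=> i j; rewrite !mxE; case: eqP => _; last by rewrite !mulr0 addr0.
by rewrite -!rmorphM -rmorphD.
Qed.

Lemma perm2 (a b : 'I_N) : a != b -> exists2 q : {perm 'I_N}, q c0 = a & q c1 = b.
Proof.
(* Where the first swap sends c1. It differs from a, so the second swap brings it to b without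
   disturbing a. *)
move=> ab; pose e := tperm c0 a c1.
exists (tperm c0 a * tperm e b)%g; rewrite !permM ?tpermL //.
have ea : e != a by rewrite /e -[X in _ != X](tpermL c0 a) (inj_eq perm_inj).
by rewrite tpermD // eq_sym.
Qed.

Lemma cl_transfer x (a b : 'I_N) (d : R) : a != b -> 0 <= d -> d * 2 <= x a - x b ->
  cl r (rdiag x) (rdiag (transfer x a b d)).
Proof.
move=> ab d0 hd; have [q qa qb] := perm2 ab.
(* Mixing with weight mu lowers the entry at a by mu (x a - x b). If the two entries agree, then d =
   0 and division by zero gives the correct weight 0. *)
pose mu := d / (x a - x b).
have hmu : 0 <= mu <= 1 / 2 /\ mu * (x a - x b) = d.
  have [e|ne] := eqVneq (x a - x b) 0.
    by rewrite /mu e in hd *; rewrite invr0 !mulr0; split; [apply/andP; split|]; lra.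
  have p : 0 < x a - x b by rewrite lt_neqAle eq_sym ne; lra.
  rewrite /mu divfK //; split=> //.
  by rewrite divr_ge0 ?(ltW p) //= ler_pdivrMr //; lra.
case: hmu => hmu emu.
have h1 := all_conj (rdiag x) (unitary_perm q).
have h2 := cl_conj_mixture (conjU (perm_mx q) (rdiag x)) unitary_protect hmu.
have h3 := cl_trans cr h1 h2.
rewrite conjU_perm_rdiag conj_protect_rdiag rdiag_comb in h3.
have h4 := cl_trans cr h3 (all_conj _ (unitary_perm q^-1)).
rewrite conjU_perm_rdiag in h4.
suff -> : transfer x a b d = (fun i => (1 - mu) * x (q (q^-1%g i)) + mu * x (q (tperm c0 c1 (q^-1%g i)))).
  exact: h4.
apply: funext => i; rewrite permKV /transfer.
have [->|ia] := eqVneq i a; first by rewrite -{3}qa permK tpermL qb; lra.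
have [->|ib] := eqVneq i b; first by rewrite -{3}qb permK tpermR qa; lra.
rewrite tpermD ?permKV; first by lra.
  by apply: contra_neq ia => e; rewrite -qa e permKV.
by apply: contra_neq ib => e; rewrite -qb e permKV.
Qed.

Lemma cl_rdiag x y : nonincr y -> (forall k, (k <= N)%N -> psum k y <= psum k x) ->
  psum N x = psum N y -> cl r (rdiag x) (rdiag y).
Proof.
move=> sy dom tot.
apply: (@hlp R N (fun x y => cl r (rdiag x) (rdiag y)) y _ _ _ sy x dom tot).
- by move=> z; exact: cl_refl.
- by move=> z z' z''; exact: cl_trans.
- exact: cl_transfer.
Qed.

End Protect.

(** * The control system *)

Definition toC (z : Defs.C) : R[i] := Complex (Defs.re z) (Defs.im z).
Definition ofC (z : R[i]) : Defs.C := Defs.mkC (complex.Re z) (complex.Im z).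
Lemma toCK z : ofC (toC z) = z. Proof. by case: z. Qed.
Lemma ofCK z : toC (ofC z) = z. Proof. by case: z. Qed.
Lemma toC_inj : injective toC. Proof. exact: can_inj toCK. Qed.
Lemma toCD a b : toC (Defs.Cadd a b) = toC a + toC b. Proof. by []. Qed.
Lemma toCM a b : toC (Defs.Cmul a b) = toC a * toC b. Proof. by []. Qed.
Lemma toC_conj a : toC (Defs.Cconj a) = conjc (toC a). Proof. by []. Qed.
Lemma toC_R r : toC (Defs.RtoC r) = r%:C. Proof. by []. Qed.
Lemma toC_N1 : toC (Defs.RtoC (-1)) = -1.
Proof. by apply/eqP; rewrite eq_complex /= oppr0 !eqxx. Qed.
Lemma toC_sum n f : toC (Defs.Csum n f) = \sum_(i < n) toC (f i).
Proof. by elim: n => [|n IH]; rewrite ?big_ord0 // big_ord_recr /= -IH. Qed.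
Lemma RsumE n f : Defs.Rsum n f = \sum_(i < n) f i.
Proof. by elim: n => [|n IH]; rewrite ?big_ord0 // big_ord_recr /= -IH. Qed.

Section Bridge.
Variable N : nat.
Local Notation M := 'M[R[i]]_N.

Definition toM (A : Defs.Mat) : M := \matrix_(i, j) toC (A i j).
(** The value outside the N by N block is a mere default, invisible to [meq]. *)
Definition ofM (A : M) : Defs.Mat := fun i j =>
  if insub i is Some i' then if insub j is Some j' then ofC (A i' j') else Defs.C0 else Defs.C0.

Lemma ofM_ord (A : M) (i j : 'I_N) : ofM A i j = ofC (A i j).
Proof. by rewrite /ofM !valK. Qed.
Lemma ofMK (A : M) : toM (ofM A) = A.
Proof. by apply/matrixP=> i j; rewrite mxE ofM_ord ofCK. Qed.

Lemma meqP A B : Defs.meq N A B <-> toM A = toM B.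
Proof.
split=> [h|/matrixP h i j /ssrnat.ltP hi /ssrnat.ltP hj].
  by apply/matrixP=> i j; rewrite !mxE h //; apply/ssrnat.ltP.
by have := h (Ordinal hi) (Ordinal hj); rewrite !mxE => /toC_inj.
Qed.

Lemma toM_mul A B : toM (Defs.mmul N A B) = toM A *m toM B.
Proof.
apply/matrixP=> i j; rewrite !mxE toC_sum; apply: eq_bigr => k _.
by rewrite !mxE toCM.
Qed.
Lemma toM_add A B : toM (Defs.madd A B) = toM A + toM B.
Proof. by apply/matrixP=> i j; rewrite !mxE. Qed.
Lemma toM_sub A B : toM (Defs.msub A B) = toM A - toM B.
Proof. by apply/matrixP=> i j; rewrite !mxE. Qed.
Lemma toM_scale c A : toM (Defs.mscale c A) = toC c *: toM A.
Proof. by apply/matrixP=> i j; rewrite !mxE. Qed.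
Lemma toM_adj A : toM (Defs.adj A) = dag (toM A).
Proof. by apply/matrixP=> i j; rewrite dagE !mxE. Qed.
Lemma toM_comm A B : toM (Defs.comm N A B) = ad (toM A) (toM B).
Proof. by rewrite /Defs.comm toM_sub !toM_mul. Qed.
Lemma toM_zero : toM Defs.mzero = 0.
Proof. by apply/matrixP=> i j; rewrite !mxE. Qed.
Lemma toM_id : toM Defs.mid = 1%:M.
Proof.
apply/matrixP=> i j; rewrite !mxE /Defs.mid.
by case: (PeanoNat.Nat.eqb_spec i j) => [/val_inj->|/eqP]; rewrite ?eqxx //= -val_eqE => /negbTE->.
Qed.
Lemma toM_diag l : toM (Defs.diag l) = rdiag (fun i => l i).
Proof.
apply/matrixP=> i j; rewrite !mxE /Defs.diag.
by case: (PeanoNat.Nat.eqb_spec i j) => [/val_inj->|/eqP]; rewrite ?eqxx //= val_eqE => /negbTE->.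
Qed.
Lemma toC_trace A : toC (Defs.trace N A) = \tr (toM A).
Proof. by rewrite toC_sum; apply: eq_bigr => i _; rewrite mxE. Qed.

Lemma unitaryP A : Defs.unitary N A <-> is_unitary (toM A).
Proof.
rewrite /Defs.unitary !meqP !toM_mul toM_adj toM_id; split=> [[]//|h].
by split=> //; exact: unitaryV.
Qed.
Lemma hermitianP A : Defs.hermitian N A <-> dag (toM A) = toM A.
Proof. by rewrite /Defs.hermitian meqP toM_adj. Qed.
Lemma in_suP A : Defs.in_su N A <-> dag (toM A) = - toM A /\ \tr (toM A) = 0.
Proof.
rewrite /Defs.in_su /Defs.skew_hermitian meqP toM_adj toM_scale -toC_trace.
rewrite toC_N1 scaleN1r; split=> -[-> h]; split=> //; first by rewrite h.
exact: toC_inj.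
Qed.

Lemma Rsum_psum k l : (k <= N)%N -> Defs.Rsum k l = psum k (fun i : 'I_N => l i).
Proof. by move=> kN; rewrite RsumE (big_ord_widen N). Qed.

Lemma sorted_spectrumP A l : Defs.is_sorted_spectrum N A l <->
  nonincr (fun i : 'I_N => l i) /\ exists2 U : M, is_unitary U & toM A = conjU U (rdiag (fun i => l i)).
Proof.
split=> [[hl [U [/unitaryP hU /meqP]]]|[hl [U hU eA]]].
  rewrite !toM_mul toM_adj toM_diag => eA; split; last by exists (toM U).
  have step (i k : nat) : (i + k < N)%N -> l (i + k)%N <= l i.
    elim: k => [|k IH]; rewrite ?addn0 // addnS => h.
    by apply: le_trans (IH (ltnW h)); apply/RleP; apply: hl; exact/ssrnat.ltP.
  by move=> i j ij; rewrite -(subnKC ij); apply: step; rewrite subnKC.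
split.
  move=> k /ssrnat.ltP kN; apply/RleP.
  exact: (hl (Ordinal (ltnW kN)) (Ordinal kN) (leqnSn k)).
exists (ofM U); split; first by apply/unitaryP; rewrite ofMK.
by apply/meqP; rewrite !toM_mul toM_adj toM_diag ofMK.
Qed.

End Bridge.

Section HasDerivSub.
Context {N : nat}.
Local Notation M := 'M[R[i]]_N.

Lemma has_derivB (phi psi : R -> M) t D E : has_deriv phi t D -> has_deriv psi t E ->
  has_deriv (fun s => phi s - psi s) t (D - E).
Proof.
move=> /has_derivP h1 /has_derivP h2; apply/has_derivP => p.
have := Ranalysis1.derivable_pt_lim_minus _ _ _ _ _ (h1 p) (h2 p).
rewrite coB (_ : (fun s => co (phi s - psi s) p) = (fun s => co (phi s) p - co (psi s) p)) //.
by apply: funext => s; rewrite coB.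
Qed.

Lemma tangent_mix_ad (K : M) : dag K = - K -> tangent mix_rel (ad K).
Proof.
move=> /spectral_skew[V [th [hV ->]]]; apply: (expU_tangent contractive_mix hV) => t A _.
apply: cl_of; exists (conjU (expU V th t)) => //.
exact/mix_conj/unitary_expU.
Qed.

End HasDerivSub.

(** * Reachable sets of the bit-flip control system *)

Section Dynamics.
Variables (n m : nat) (H : nat -> Defs.Mat) (gstar : R).
Hypothesis hn : (1 <= n)%coq_nat.
Local Notation N := (Nat.pow 2 n).
Local Notation M := 'M[R[i]]_N.

Lemma partner_ltn (i : 'I_N) : (RealFacts.partner i < N)%N.
Proof. by apply/ssrnat.ltP/RealFacts.partner_lt => //; apply/ssrnat.ltP. Qed.
Definition partner_ord (i : 'I_N) : 'I_N := Ordinal (partner_ltn i).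
Lemma partner_ordK : involutive partner_ord.
Proof. by move=> i; apply: val_inj; exact: RealFacts.partnerK. Qed.
Definition partner_perm : {perm 'I_N} := perm (inv_inj partner_ordK).
Lemma partner_permK i : partner_perm (partner_perm i) = i.
Proof. by rewrite !permE partner_ordK. Qed.

Local Notation X := (perm_mx partner_perm : M).

Lemma unitary_X : is_unitary X. Proof. exact: unitary_perm. Qed.
Lemma dag_X : dag X = X.
Proof.
rewrite dag_perm; congr perm_mx; apply/permP => i.
by apply: (@perm_inj _ partner_perm); rewrite permKV partner_permK.
Qed.
Lemma X_mul_X : X *m X = 1%:M.
Proof. by rewrite -{2}dag_X unitary_X. Qed.

Lemma toM_Vb : toM N Defs.Vb = (1 / 2)%:C *: X.
Proof.
apply/matrixP=> i j; rewrite !mxE RealFacts.Vb_entry permE.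
case: (PeanoNat.Nat.eqb_spec (RealFacts.partner i) j) => [e|ne].
  have -> : partner_ord i == j by apply/eqP/val_inj.
  by rewrite mulr1 toC_R !RealsE.
have -> : partner_ord i == j = false by apply/eqP => e; apply: ne; rewrite -e.
by rewrite mulr0.
Qed.

Lemma toM_lindblad A : toM N (Defs.lindblad N Defs.Vb A) = (- (1 / 4))%:C *: flip X (toM N A).
Proof.
rewrite /Defs.lindblad toM_sub toM_scale toM_add !toM_mul toM_adj toM_Vb dagZr dag_X.
move: (toM N A) => B.
have -> : (1 / 2)%:C *: X *m ((1 / 2)%:C *: X) = (1 / 4)%:C *: 1%:M :> M.
  by rewrite -scalemxAl -scalemxAr X_mul_X scalerA -rmorphM; congr (_%:C *: _); field.
rewrite -!scalemxAl -!scalemxAr mul1mx mulmx1 /flip /conjU dag_X.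
rewrite toC_R !RealsE -[nat_of_pos 2]/2%N; move: (X *m B *m X) => D.
by apply: coP => p; rewrite coB !coZ coD !coZ coB; field.
Qed.

Definition gen (K : M) (g : R) (A : M) := ad K A + (g / 4)%:C *: flip X A.
Lemma blin_gen K g : blin (gen K g).
Proof. exact: blin_add (blin_ad K) (blin_scale _ (blin_flip unitary_X)). Qed.

Definition iH k : M := 'i *: toM N (H k).
Definition drive (u : nat -> R) : M := - (iH 0 + \sum_(k < m) (u k.+1)%:C *: iH k.+1).

Lemma toM_ham u : toM N (Defs.ham m H u) = toM N (H 0) + \sum_(k < m) (u k.+1)%:C *: toM N (H k.+1).
Proof.
apply/matrixP=> i j; rewrite !mxE toCD toC_sum; congr (_ + _).
by rewrite summxE; apply: eq_bigr => k _; rewrite !mxE toCM toC_R.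
Qed.

Lemma toM_generator u g A : toM N (Defs.generator N m H u g A) = gen (drive u) g (toM N A).
Proof.
rewrite /Defs.generator toM_scale toC_N1 toM_add !toM_scale toM_comm toM_lindblad toM_ham !toC_R.
have -> : drive u = - ('i *: (toM N (H 0) + \sum_(k < m) (u k.+1)%:C *: toM N (H k.+1))).
  rewrite /drive scalerDr scaler_sumr; congr (- (_ + _)); apply: eq_bigr => k _.
  by rewrite /iH !scalerA mulrC.
have -> : toC Defs.Ci = 'i by [].
move: (toM N (H 0) + _) => K; rewrite /gen adNl adZl.
rewrite scaleN1r opprD; congr (_ + _).
by rewrite scalerA -scaleNr -rmorphM -rmorphN; congr (_%:C *: _); field.
Qed.

Lemma flowP u g t r1 r2 : Defs.flow N m H u g t r1 r2 <->
  exists phi : R -> M, [/\ phi 0 = toM N r1, phi t = toM N r2 &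
    forall s, has_deriv phi s (gen (drive u) g (phi s))].
Proof.
split=> [[f [/meqP f0 [/meqP ft hf]]]|[phi [p0 pt hp]]].
  exists (fun s => toM N (f s)); split=> // s; apply/has_derivP => -[[i j] b].
  rewrite -toM_generator.
  have [h1 h2] := hf s i j (elimT ssrnat.ltP (ltn_ord i)) (elimT ssrnat.ltP (ltn_ord j)).
  have e (F : Defs.Mat) b' : co (toM N F) (i, j, b') = if b' then Defs.re (F i j) else Defs.im (F i j).
    by rewrite /co /= mxE; case: b'.
  rewrite e (_ : (fun s => _) = (fun s => if b then Defs.re (f s i j) else Defs.im (f s i j))); last first.
    by apply: funext => s'; rewrite e.
  by case: b.
exists (fun s => ofM (phi s)); split; first by apply/meqP; rewrite ofMK.
split; first by apply/meqP; rewrite ofMK.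
move=> s i j /ssrnat.ltP hi /ssrnat.ltP hj; have /has_derivP h := hp s.
have e b : Ranalysis1.derivable_pt_lim (fun s' => if b then Defs.re (ofM (phi s') i j) else Defs.im (ofM (phi s') i j)) s
   (if b then Defs.re (Defs.generator N m H u g (ofM (phi s)) i j) else Defs.im (Defs.generator N m H u g (ofM (phi s)) i j)).
  have := h (Ordinal hi, Ordinal hj, b).
  rewrite -{1}(ofMK (phi s)) -toM_generator /co /= !mxE.
  rewrite (_ : (fun s0 => _) = (fun s' => if b then Defs.re (ofM (phi s') i j) else Defs.im (ofM (phi s') i j))); last first.
    apply: funext => s'; rewrite (ofM_ord (phi s') (Ordinal hi) (Ordinal hj)).
    by case: b.
  by case: b.
by split; [exact: (e true) | exact: (e false)].
Qed.

Lemma flow_meq u g t r1 r1' r2 : toM N r1 = toM N r1' ->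
  Defs.flow N m H u g t r1 r2 -> Defs.flow N m H u g t r1' r2.
Proof. by move=> e /flowP[phi [p0 pt hp]]; apply/flowP; exists phi; rewrite -e. Qed.

Local Notation reach := (Defs.reach N m H gstar).

Lemma reach_meq r1 r1' r2 : toM N r1 = toM N r1' -> reach r1 r2 -> reach r1' r2.
Proof.
move=> e h; case: h e => [a b /meqP ab e|a b c t u g t0 hg hf hr e].
  by apply: Defs.reach_refl; apply/meqP; rewrite -e.
apply: Defs.reach_step t0 hg _ hr; exact: flow_meq hf.
Qed.

Lemma reach_trans r1 r2 r3 : reach r1 r2 -> reach r2 r3 -> reach r1 r3.
Proof.
elim=> {r1 r2} [a b /meqP ab|a b c t u g t0 hg hf _ IH h]; first by apply: reach_meq; rewrite ab.
exact: Defs.reach_step t0 hg hf (IH h).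
Qed.

Hypothesis skew_iH : forall k, (k <= m)%N -> dag (iH k) = - iH k.
Hypothesis gstar_gt0 : 0 < gstar.

Lemma skew_drive u : dag (drive u) = - drive u.
Proof.
rewrite /drive dagN; congr (- _); rewrite dagD skew_iH // opprD; congr (_ + _).
have -> : dag (\sum_(k < m) (u k.+1)%:C *: iH k.+1) = \sum_(k < m) dag ((u k.+1)%:C *: iH k.+1).
  exact: (big_morph _ dagD dag0).
rewrite -sumrN; apply: eq_bigr => k _.
by rewrite dagZr skew_iH // scalerN.
Qed.

Lemma tangent_mix_gen u g : 0 <= g -> tangent mix_rel (gen (drive u) g).
Proof.
move=> g0; apply: (tangentD contractive_mix); [exact: blin_ad | exact: blin_scale (blin_flip unitary_X) | |].
  exact/tangent_mix_ad/skew_drive.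
apply: (tangentZ contractive_mix); last exact/tangent_mix_flip/unitary_X.
by rewrite divr_ge0.
Qed.

Lemma flow_mix u g (phi : R -> M) t : 0 <= g -> 0 <= t ->
  (forall s, has_deriv phi s (gen (drive u) g (phi s))) -> cl mix_rel (phi 0) (phi t).
Proof. move=> g0 t0; exact: (tangent_flow contractive_mix t0 (tangent_mix_gen u g0)). Qed.

Lemma amplitude_ge0 g : g = 0 \/ g = gstar -> 0 <= g.
Proof. by case=> ->; [|exact: ltW]. Qed.

Lemma reach_mix r1 r2 : reach r1 r2 -> cl mix_rel (toM N r1) (toM N r2).
Proof.
elim=> {r1 r2} [a b /meqP ->|a b c t u g /RleP t0 hg /flowP[phi [<- pt hp]] _ IH].
  exact: (cl_refl contractive_mix).
apply: (cl_trans contractive_mix) IH; rewrite -pt.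
exact: flow_mix (amplitude_ge0 hg) t0 hp.
Qed.

(** The same controls are applied from A'. The difference of the two solutions solves the same
    linear equation, so it ends in the closure of the mixed unitary images of the initial
    difference, and its norm does not grow. *)
Lemma reach_follow r1 r2 (A' : M) : reach r1 r2 ->
  exists2 r2', reach (ofM A') r2' & nrm (toM N r2' - toM N r2) <= nrm (A' - toM N r1).
Proof.
move=> h; elim: h A' => {r1 r2} [a b /meqP ab|a b c t u g t0 hg /flowP[phi [p0 pt hp]] _ IH] A'.
  exists (ofM A'); first exact: Defs.reach_refl.
  by rewrite ofMK ab.
have [psi [psi0 hpsi]] := linear_ode A' (blin_gen (drive u) g).
have [r2' h1 h2] := IH (psi t); exists r2'.
  apply: (Defs.reach_step _ _ _ _ _ (ofM (psi t)) _ t u g) => //.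
  by apply/flowP; exists psi; rewrite !ofMK.
apply: le_trans h2 _; rewrite -pt -p0 -psi0.
have t0R : 0 <= t by apply/RleP.
have hD s : has_deriv (fun s => psi s - phi s) s (gen (drive u) g (psi s - phi s)).
  by rewrite (blinB (psi s) (phi s) (blin_gen (drive u) g)); apply: has_derivB; [exact: hpsi | exact: hp].
exact: (cl_nrm contractive_mix (flow_mix (amplitude_ge0 hg) t0R hD)).
Qed.

Definition reachM (A B : M) := exists2 rho, reach (ofM A) rho & toM N rho = B.

Lemma contractive_reach : contractive reachM.
Proof.
split.
- by move=> A; exists (ofM A); [exact: Defs.reach_refl | rewrite ofMK].
- move=> A B C [r h <-] [r' h' <-]; exists r' => //; apply: (reach_trans h).
  by apply: reach_meq h'; rewrite ofMK.
- move=> A B A' [r h <-]; have [r' h1] := reach_follow A' h.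
  by rewrite ofMK => h2; exists (toM N r') => //; exists r'.
- move=> B [r /reach_mix h <-]; rewrite ofMK in h; apply: nrm_eq0; apply/eqP.
  by rewrite eq_le nrm_ge0 andbT -[leRHS](@nrm0 R N); exact: (cl_nrm contractive_mix h).
Qed.

Lemma tangent_reach_gen u g : g = 0 \/ g = gstar -> tangent reachM (gen (drive u) g).
Proof.
move=> hg; apply: (flow_tangent contractive_reach); first exact: blin_gen.
move=> A; have [phi [p0 hp]] := linear_ode A (blin_gen (drive u) g).
exists phi; split=> // t t0; apply: cl_of; exists (ofM (phi t)); last by rewrite ofMK.
apply: (Defs.reach_step _ _ _ _ _ (ofM (phi t)) _ t u g) => //; first exact/RleP.
  by apply/flowP; exists phi; rewrite !ofMK.
exact: Defs.reach_refl.
Qed.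

Lemma inlie_drive u : inlie reachM (drive u).
Proof.
apply: (inlie_recurrent contractive_reach); first exact: skew_drive.
apply: tangent_ext (tangent_reach_gen u (or_introl erefl)) => A.
by rewrite /gen mul0r scale0r addr0.
Qed.

(** Zero controls give the drift direction and, by recurrence, its negative; a unit value of the
    k-th control gives iH_0 + iH_k up to sign, from which iH_0 is subtracted. *)
Lemma inlie_iH k : (k <= m)%N -> inlie reachM (iH k).
Proof.
have h0 : inlie reachM (iH 0).
  have := inlieN (inlie_drive (fun=> 0)).
  by rewrite /drive opprK big1 ?addr0 // => j _; rewrite scale0r.
case: k => [_|k km]; first exact: h0.
pose u (j : nat) : R := (j == k.+1)%:R.
have sum_iH : \sum_(j < m) (u j.+1)%:C *: iH j.+1 = iH k.+1.
  rewrite (bigD1 (Ordinal km)) //= big1 => [|j]; first by rewrite addr0 /u eqxx scale1r.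
  by rewrite -val_eqE /= /u eqSS => /negbTE->; rewrite scale0r.
have := inlieD contractive_reach (inlieN (inlie_drive u)) (inlieN h0).
by rewrite /drive opprK sum_iH addrAC subrr add0r; apply.
Qed.

(** [lie_generated] means membership in every Lie subalgebra that contains the generators, so it can
    be instantiated with this one. *)
Lemma lie_subalgebra_inlie : Defs.lie_subalgebra N (fun Y => inlie reachM (toM N Y)).
Proof.
split; [|split; [|split; [|split]]].
- by move=> A B /meqP ->.
- by rewrite toM_zero; exact: (inlie0 contractive_reach).
- by move=> A B hA hB; rewrite toM_add; exact: (inlieD contractive_reach).
- by move=> c A hA; rewrite toM_scale toC_R; exact: (inlieZ contractive_reach).
- by move=> A B hA hB; rewrite toM_comm; exact: (inlie_comm contractive_reach).
Qed.

Hypothesis lie_su : forall Y, Defs.in_su N Y ->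
  Defs.lie_generated N m (fun k => Defs.mscale Defs.Ci (H k)) Y.

Lemma inlie_su (Y : M) : dag Y = - Y -> \tr Y = 0 -> inlie reachM Y.
Proof.
move=> h1 h2; have hY : Defs.in_su N (ofM Y) by apply/in_suP; rewrite ofMK.
have := lie_su hY lie_subalgebra_inlie; rewrite ofMK; apply=> k /ssrnat.leP km.
rewrite toM_scale (_ : toC Defs.Ci = 'i) //; exact: inlie_iH.
Qed.

Lemma N_gt0 : (0 < N)%N.
Proof. by apply/ssrnat.ltP/PeanoNat.Nat.neq_0_lt_0/PeanoNat.Nat.pow_nonzero. Qed.

Lemma cl_reach_unitary (U A : M) : is_unitary U -> cl reachM A (conjU U A).
Proof. exact: (all_unitary contractive_reach A N_gt0 inlie_su). Qed.

Lemma tangent_reach_flip : tangent reachM (fun A => (gstar / 4)%:C *: flip X A).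
Proof.
have h1 := tangent_reach_gen (fun=> 0) (or_intror erefl).
have [_ _ h2] := inlie_drive (fun=> 0).
apply: tangent_ext (tangentD contractive_reach (blin_gen _ _) (blin_ad _) h1 h2) => A.
by rewrite /gen adNl addrAC subrr add0r.
Qed.

Lemma cl_reach_mixture (A : M) (mu : R) : 0 <= mu <= 1 / 2 ->
  cl reachM A ((1 - mu)%:C *: A + mu%:C *: conjU X A).
Proof.
apply: (flip_mixture contractive_reach _ _ dag_X X_mul_X tangent_reach_flip).
by rewrite divr_gt0.
Qed.

Lemma cl_reach_rdiag (x y : 'I_N -> R) : nonincr y ->
  (forall k, (k <= N)%N -> psum k y <= psum k x) -> psum N x = psum N y ->
  cl reachM (rdiag x) (rdiag y).
Proof.
apply: (@cl_rdiag _ _ partner_perm (fun i => Nat.even i) (Ordinal N_gt0) partner_permK _ reachM contractive_reach cl_reach_unitary cl_reach_mixture).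
by move=> i; rewrite permE; exact: RealFacts.even_partner.
Qed.

Lemma majorised_cl_reach rho rho0 : Defs.majorised N rho rho0 ->
  cl reachM (toM N rho0) (toM N rho).
Proof.
move=> [l [l' [/sorted_spectrumP[hl [U hU ->]] [/sorted_spectrumP[_ [V hV ->]] [dom tot]]]]].
have c1 := cl_reach_unitary (conjU V (rdiag (fun i => l' i))) (unitary_dag hV).
rewrite (conjUK _ hV) in c1.
have c2 : cl reachM (rdiag (fun i => l' i)) (rdiag (fun i => l i)).
  apply: cl_reach_rdiag hl _ _ => [k kN|].
    by rewrite -!Rsum_psum //; apply/RleP/dom/ssrnat.leP.
  by rewrite -!Rsum_psum.
exact: (cl_trans contractive_reach c1 (cl_trans contractive_reach c2 (cl_reach_unitary _ hU))).
Qed.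

Lemma reach_closureP rho0 rho : Defs.reach_closure N m H gstar rho0 rho <->
  cl reachM (toM N rho0) (toM N rho).
Proof.
have coE (F F' : Defs.Mat) (i j : 'I_N) b : co (toM N F - toM N F') (i, j, b) =
    if b then Defs.re (F i j) - Defs.re (F' i j) else Defs.im (F i j) - Defs.im (F' i j).
  by rewrite coB /co /= !mxE; case: b.
split=> h e e0.
  pose c : R := #|{: 'I_N * 'I_N * bool}|%:R + 1.
  have c0 : 0 < c by rewrite ltr_wpDl.
  have q0 : 0 < e / c by rewrite divr_gt0.
  have [rho' [hr hc]] := h _ (elimT RltP q0).
  exists (toM N rho'); first by exists rho' => //; apply: reach_meq hr; rewrite ofMK.
  apply: le_lt_trans (@nrm_le_bound _ _ _ (e / c) _) _.
    move=> [[i j] b]; rewrite coE.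
    have [h1 h2] := hc i j (elimT ssrnat.ltP (ltn_ord i)) (elimT ssrnat.ltP (ltn_ord j)).
    by case: b; apply: ltW; apply/RltP; rewrite -RabsE.
  by rewrite mulrCA -ltr_pdivlMl // mulVf ?gt_eqF // ltr_pdivrMr // mul1r ltrDl.
have e0' : 0 < e by apply/RltP.
have [B [r hr <-] hB] := h e e0'.
exists r; split; first by apply: reach_meq hr; rewrite ofMK.
move=> i j /ssrnat.ltP hi /ssrnat.ltP hj.
have hco b := co_le (toM N r - toM N rho) (Ordinal hi, Ordinal hj, b).
have := hco true; have := hco false; rewrite !coE /= => h1 h2.
by split; apply/RltP; rewrite RabsE; apply: le_lt_trans hB.
Qed.

End Dynamics.

(** * Limits of mixed unitary images: density matrices and majorisation *)

Section MixMajorised.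
Context {N : nat}.
Local Notation M := 'M[R[i]]_N.
Hypothesis N0 : (0 < N)%N.

(** Here W ranges over all matrices: its first rows then exhaust all vectors, and the case k = 1
    expresses positivity. *)
Lemma mix_kyfan_ge0 k F : mixed_unitary F -> forall A : M,
  (forall W, 0 <= kyfan k W A) -> forall W, 0 <= kyfan k W (F A).
Proof.
elim=> {F} [U hU A h W|t F G /andP[t0 t1] _ hF _ hG A h W|F G _ hF _ hG A h].
- by rewrite kyfan_conj.
- rewrite kyfanD !kyfanZ; have := hF A h W; have := hG A h W; nra.
- exact/hG/hF.
Qed.

Lemma kyfan_bound k (W : M) : exists2 c : R, 0 <= c & forall A, kyfan k W A <= c * nrm A.
Proof.
have [K K0 hK] := @nrmM R N.
exists (N%:R * (K * (K * nrm W * nrm (dag W)))).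
  by rewrite !mulr_ge0 ?nrm_ge0.
move=> A; apply: le_trans (_ : N%:R * nrm (conjU W A) <= _).
  by rewrite -[in leLHS](mul1mx W) -kyfan_conj; apply: kyfan_le unitary1.
rewrite -[leRHS]mulrA ler_wpM2l //; apply: le_trans (hK _ _) _.
rewrite -[leRHS]mulrA ler_wpM2l // mulrAC ler_wpM2r ?nrm_ge0 // -mulrA.
exact: hK.
Qed.

Lemma cl_mix_kyfan_ge0 k (A B : M) : cl mix_rel A B -> (forall W, 0 <= kyfan k W A) ->
  forall W, 0 <= kyfan k W B.
Proof.
move=> cAB h W; have [c c0 hc] := kyfan_bound k W.
apply/ler_addgt0Pr => e e0.
have q0 : 0 < e / (c + 1) by rewrite divr_gt0 // ltr_wpDl.
have [B' [F hF ->] hB] := cAB _ q0.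
have h1 := mix_kyfan_ge0 hF h W.
have := hc (F A - B); rewrite kyfanD kyfanN => h2.
move: hB; rewrite ltr_pdivlMr ?ltr_wpDl // => hB.
have := nrm_ge0 (F A - B); nra.
Qed.

Let o : 'I_N := Ordinal N0.

Lemma kyfan1 (W A : M) : kyfan 1 W A = complex.Re (conjU W A o o).
Proof.
rewrite /kyfan (big_pred1 o) // => i.
by rewrite ltnS leqn0 /= -val_eqE.
Qed.

(** When the first row of W is v^*, the corner entry of W A W^* is v^* A v. *)
Lemma qformE (W : M) (v : Defs.Vec) A : (forall i : 'I_N, toC (v i) = conjc (W o i)) ->
  Defs.re (Defs.qform N A v) = kyfan 1 W (toM N A).
Proof.
move=> hv; rewrite kyfan1 -[LHS]/(complex.Re (toC _)) toC_sum; congr complex.Re.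
rewrite mxE; under [RHS]eq_bigr => j _ do rewrite mxE mulr_suml.
rewrite exchange_big /=; apply: eq_bigr => i _; rewrite toC_sum; apply: eq_bigr => j _.
by rewrite !toCM toC_conj !hv conjcK dagE mxE mulrA.
Qed.

Lemma psdP A : Defs.psd N A <-> dag (toM N A) = toM N A /\ forall W, 0 <= kyfan 1 W (toM N A).
Proof.
rewrite /Defs.psd hermitianP; split=> -[hA h].
  split=> [//|W]; have /RleP := h (fun i => Defs.Cconj (ofM W 0 i)).
  rewrite (@qformE W) // => i; rewrite toC_conj; congr conjc.
  by rewrite (ofM_ord W o i) ofCK.
split=> [//|v]; apply/RleP; rewrite (@qformE (\matrix_(_, i) conjc (toC (v i)))) ?h // => i.
by rewrite mxE conjcK.
Qed.

Definition extend (l : 'I_N -> R) (k : nat) : R := oapp l 0 (insub k).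
Lemma extendE l : (fun i : 'I_N => extend l i) = l.
Proof. by apply: funext => i; rewrite /extend valK. Qed.

Lemma cl_mix_density rho0 rho : Defs.density N rho0 -> cl mix_rel (toM N rho0) (toM N rho) ->
  Defs.density N rho.
Proof.
move=> [/hermitianP h0 [/psdP[_ p0] t0]] c.
have h := cl_mix_herm c h0; split; first exact/hermitianP.
split; first by apply/psdP; split=> //; exact: cl_mix_kyfan_ge0 c p0.
apply: toC_inj; rewrite toC_trace.
have : conjc (\tr (toM N rho)) = \tr (toM N rho).
  by rewrite -{2}h /dag /mxtrace rmorph_sum; apply: eq_bigr => i _; rewrite !mxE.
have := cl_mix_trace c; rewrite -(toC_trace N rho0) t0.
case: (\tr _) => a b /= -> [] hb; have -> : b = 0 by lra.
by [].
Qed.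

Lemma cl_mix_majorised rho0 rho : Defs.density N rho0 -> cl mix_rel (toM N rho0) (toM N rho) ->
  Defs.majorised N rho rho0.
Proof.
move=> [/hermitianP h0 _] c.
have h := cl_mix_herm c h0.
have [U [l [hU sl e]]] := spectral_sorted h.
have [V [l' [hV sl' e']]] := spectral_sorted h0.
have kf k : (k <= N)%N -> psum k l <= psum k l'.
  (* The partial sum of the spectrum of rho is its Ky Fan functional at U^*; for rho0 the functional
     is bounded at every unitary by [schur_bound], and the bound passes to rho. *)
  move=> kN; rewrite -kyfan_rdiag -(conjUK (rdiag l) hU) -e kyfan_conj mul1mx.
  apply: (cl_mix_kyfan c) (unitary_dag hU) => W hW.
  by rewrite e' kyfan_conj; apply: schur_bound => //; exact: unitaryM.
exists (extend l), (extend l'); split; [|split; [|split]].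
- by apply/sorted_spectrumP; rewrite extendE; split=> //; exists U.
- by apply/sorted_spectrumP; rewrite extendE; split=> //; exists V.
- by move=> k /ssrnat.leP kN; apply/RleP; rewrite !(Rsum_psum _ kN) !extendE; exact: kf.
rewrite !(Rsum_psum _ (leqnn N)) !extendE.
have tr (x : 'I_N -> R) (Q : M) : is_unitary Q -> complex.Re (\tr (conjU Q (rdiag x))) = psum N x.
  move=> hQ; rewrite (mix_trace (mix_conj hQ)) /mxtrace Re_sum /psum.
  apply: eq_big => [i|i _]; first by rewrite ltn_ord.
  by rewrite mxE eqxx.
by have := cl_mix_trace c; rewrite e e' !tr.
Qed.

End MixMajorised.

Theorem reach_closure_majorised (n m : nat) (H : nat -> Defs.Mat) (gstar : R) (rho0 : Defs.Mat) :
  (1 <= n)%coq_nat ->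
  (forall Y, Defs.lie_generated (Nat.pow 2 n) m (fun k => Defs.mscale Defs.Ci (H k)) Y <-> Defs.in_su (Nat.pow 2 n) Y) ->
  Rlt (IZR 0) gstar -> Defs.density (Nat.pow 2 n) rho0 -> forall rho,
  Defs.reach_closure (Nat.pow 2 n) m H gstar rho0 rho <->
  (Defs.density (Nat.pow 2 n) rho /\ Defs.majorised (Nat.pow 2 n) rho rho0).
Proof.
move=> hn hL /RltP g0 d0 rho.
(* Each generator lies in the algebra it generates, so the left-to-right half of the Lie condition
   makes every iH_k skew-hermitian; the other half supplies controllability. *)
have skew k : (k <= m)%N -> dag (iH n H k) = - iH n H k.
  move=> km; have /in_suP[] : Defs.in_su (Nat.pow 2 n) (Defs.mscale Defs.Ci (H k)).
    by apply/hL => S _; apply; apply/ssrnat.leP.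
  by rewrite toM_scale.
have clP := reach_closureP m H gstar hn rho0 rho.
split=> [/clP h|[_ hmaj]]; last first.
  exact/clP/(majorised_cl_reach hn skew g0 (fun Y => proj2 (hL Y)) hmaj).
(* Reached states are already limits of mixed unitary images, so the closure of reachability needs
   one more passage to the limit. *)
have c : cl mix_rel (toM (Nat.pow 2 n) rho0) (toM (Nat.pow 2 n) rho).
  apply: cl_closed => e /h[B [r hr <-] hB]; exists (toM (Nat.pow 2 n) r) => //.
  by have := reach_mix hn skew g0 hr; rewrite ofMK.
by split; [exact: cl_mix_density (N_gt0 n) _ _ d0 c | exact: cl_mix_majorised d0 c].
Qed.

End LieWedge.

Theorem theorem2 (n m : nat) (H : nat -> Mat) (gstar : R) (rho0 : Mat) :
  (1 <= n)%nat ->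
  (* (i) <iH_0, ..., iH_m>_Lie = su(2^n) *)
  (forall X, lie_generated (2 ^ n) m (fun k => mscale Ci (H k)) X <-> in_su (2 ^ n) X) ->
  (* (ii) H_0 diagonal in the computational basis *)
  (forall i j, (i < 2 ^ n)%nat -> (j < 2 ^ n)%nat -> i <> j -> H 0%nat i j = C0) ->
  (* (iii) gamma(t) in {0, gstar}, gstar > 0 *)
  0 < gstar ->
  density (2 ^ n) rho0 ->
  forall rho : Mat,
    reach_closure (2 ^ n) m H gstar rho0 rho <->
    (density (2 ^ n) rho /\ majorised (2 ^ n) rho rho0).
Proof.
intros hn hL _ hg hd; exact (LieWedge.reach_closure_majorised hn hL hg hd).
Qed.
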